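(* For each $i\ge1$ let $u_i:Prim({\cal H}_R)^{\otimes i}\to Prim({\cal H}_R)$ be a linear map, and let $\Phi_{(u_i)}:{\cal H}_R\to{\cal H}_R$ be the linear map defined by $\Phi_{(u_i)}(1)=1$ and, for $n\ge1$ and primitive $p_1,\dots,p_n$, $$\Phi_{(u_i)}(p_n\top\cdots\top p_1)=\sum_{k=1}^{n}\ \sum_{\substack{a_1+\cdots+a_k=n\\ a_r\ge1}}\big(\overline{u_{a_1}\otimes\cdots\otimes u_{a_k}}\big)(p_n\top\cdots\top p_1).$$ Then $\Phi_{(u_i)}$ is a coalgebra endomorphism of $({\cal H}_R,\Delta,\varepsilon)$. Conversely, if $\Phi$ is a coalgebra endomorphism of $({\cal H}_R,\Delta,\varepsilon)$, then there exists a unique family of linear maps $u_i:Prim({\cal H}_R)^{\otimes i}\to Prim({\cal H}_R)$, $i\ge1$, such that $\Phi=\Phi_{(u_i)}$.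
   Context: ${\cal H}_R$ is the commutative polynomial algebra over $\mathbb{Q}$ on isomorphism classes of rooted trees (finite connected simply connected graphs with a root, edges oriented away from the root; weight = number of vertices), a Hopf algebra with coproduct the algebra morphism $\Delta(t)=1\otimes t+t\otimes1+\sum_CP^C(t)\otimes R^C(t)$ over admissible cuts $C$ (nonempty edge sets meeting each root-to-vertex path at most once; $R^C(t)$ = component containing the root, $P^C(t)$ = product of the others) and counit $\varepsilon$. $Prim({\cal H}_R)$ = primitive elements. For forests $M,N$: $M\top N=0$ if $N=1$, else $\frac{1}{weight(N)}\sum_vN_v$, $v$ over vertices of $N$, $N_v$ obtained by attaching every tree of $M$ to $v$; bilinear extension. $F_i:Prim({\cal H}_R)^{\otimes i}\to{\cal H}_R$, $p_i\otimes\cdots\otimes p_1\mapsto p_i\top\cdots\top p_1:=(\cdots(p_i\top p_{i-1})\cdots)\top p_1$. Each $F_i$ is injective and ${\cal H}_R=\mathbb{Q}1\oplus\bigoplus_{i\ge1}Im(F_i)$. For a linear map $u:Prim({\cal H}_R)^{\otimes i}\to Prim({\cal H}_R)^{\otimes j}$, $\overline u:=F_j\circ u\circ F_i^{-1}:Im(F_i)\to Im(F_j)$. In the formula, $u_{a_1}\otimes\cdots\otimes u_{a_k}$ acts on $Prim^{\otimes n}=Prim^{\otimes a_1}\otimes\cdots\otimes Prim^{\otimes a_k}$ (tensor factors ordered $p_n,\dots,p_1$). (The associated graded Hopf algebra $gr({\cal H}_R)$ for the filtration by $\mathbb{Q}1\oplus\bigoplus_{j\le n}Im(F_j)$ has the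 same underlying coalgebra.) *)

(* Defs.v *)
From HB Require Import structures.
From mathcomp Require Import all_boot all_order all_algebra.
From mathcomp Require Import finmap.
From mathcomp.multinomials Require Import monalg.

Set Implicit Arguments.
Unset Strict Implicit.
Unset Printing Implicit Defensive.

Import GRing.Theory Num.Theory.
Local Open Scope ring_scope.

(* Rooted trees (planar representatives; a vertex = list of children). *)
Inductive rtree : Type := Node of seq rtree.

Fixpoint rtree_enc (t : rtree) : GenTree.tree unit :=
  let: Node cs := t in GenTree.Node 0 (map rtree_enc cs).

Fixpoint rtree_dec (g : GenTree.tree unit) : rtree :=
  match g with
  | GenTree.Leaf _ => Node [::]
  | GenTree.Node _ gs => Node (map rtree_dec gs)
  end.

Lemma rtree_encK : cancel rtree_enc rtree_dec.
Proof.
rewrite /cancel; fix IH 1; case=> cs /=; congr Node; elim: cs => //= c cs IHcs.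
by rewrite IH IHcs.
Qed.

HB.instance Definition _ := Countable.copy rtree (can_type rtree_encK).

Definition rtree_le (t1 t2 : rtree) : bool := (@choice.pickle rtree t1 <= @choice.pickle rtree t2)%N.

(* Canonical representative of the isomorphism class of a rooted tree:
   children canonicalized recursively and sorted. *)
Fixpoint canon (t : rtree) : rtree :=
  let: Node cs := t in Node (sort rtree_le (map canon cs)).

Definition cforest (f : seq rtree) : seq rtree := sort rtree_le (map canon f).

(* Isomorphism classes of rooted forests = monomials of H_R. *)
Definition forest := {f : seq rtree | cforest f == f}.

Definition F0 : forest := @exist _ (fun f => cforest f == f) [::] isT.

(* The isomorphism class of a forest (cforest is idempotent, so insubd
   never uses its default). *)
Definition mkF (f : seq rtree) : forest := insubd F0 (cforest f).

(* H_R: the commutative polynomial algebra over Q on iso classes of rooted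
   trees, i.e. the Q-vector space with basis the forests. *)
Definition H := {malg rat[forest]}.
Definition H2 := {malg rat[(forest * forest)%type]}.

Definition One : H := << F0 >>.

Definition mulF (f g : forest) : forest := mkF (val f ++ val g).

Definition bilin (K1 K2 K3 : choiceType) (b : K1 -> K2 -> {malg rat[K3]})
  (x : {malg rat[K1]}) (y : {malg rat[K2]}) : {malg rat[K3]} :=
  \sum_(k <- msupp x) \sum_(m <- msupp y) (x@_k * y@_m) *: b k m.

Definition tensor2 (x y : H) : H2 := bilin (fun k m => << (k, m) >>) x y.

Definition mul2 (x y : H2) : H2 :=
  bilin (fun k m => << (mulF k.1 m.1, mulF k.2 m.2) >>) x y.

(* Coproduct.  Vertices are addressed by the list of child indices on the
   path from the root; the edge entering a non-root vertex a is identified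
   with a. *)
Fixpoint verts (t : rtree) : seq (seq nat) :=
  match t with
  | Node cs =>
      [::] :: (fix vl (i : nat) (l : seq rtree) : seq (seq nat) :=
                 match l with
                 | [::] => [::]
                 | c :: l' => [seq i :: a | a <- verts c] ++ vl i.+1 l'
                 end) 0%N cs
  end.

Definition edges (t : rtree) : seq (seq nat) := [seq a <- verts t | a != [::]].

Fixpoint subtree (t : rtree) (a : seq nat) {struct a} : rtree :=
  match a with
  | [::] => t
  | i :: a' => let: Node cs := t in subtree (nth (Node [::]) cs i) a'
  end.

Fixpoint prune (t : rtree) (C : seq (seq nat)) : rtree :=
  match t with
  | Node cs =>
      Node ((fix pl (i : nat) (l : seq rtree) : seq rtree :=
               match l with
               | [::] => [::]
               | c :: l' =>
                   (if [:: i] \in C then [::]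
                    else [:: prune c [seq behead a | a <- C &
                                        (1 < size a)%N && (head 0%N a == i)]])
                   ++ pl i.+1 l'
               end) 0%N cs)
  end.

Fixpoint subs (T : Type) (s : seq T) : seq (seq T) :=
  match s with
  | [::] => [:: [::]]
  | x :: s' => subs s' ++ map (cons x) (subs s')
  end.

(* admissible cut: nonempty set of edges meeting each root-to-vertex path at
   most once, i.e. no cut edge lies strictly above another one *)
Definition admissible_cut (C : seq (seq nat)) : bool :=
  (C != [::]) && all (fun a => all (fun b => (a == b) || ~~ prefix a b) C) C.

Definition DeltaT (t : rtree) : H2 :=
  << (F0, mkF [:: t]) >> + << (mkF [:: t], F0) >> +
  \sum_(C <- subs (edges t) | admissible_cut C)
     << (mkF (map (subtree t) C), mkF [:: prune t C]) >>.

(* Delta on a forest: Delta is an algebra morphism *)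
Definition DeltaB (f : forest) : H2 :=
  foldr (fun t acc => mul2 (DeltaT t) acc) << (F0, F0) >> (val f).

Definition Delta (x : H) : H2 := \sum_(k <- msupp x) x@_k *: DeltaB k.

Definition eps (x : H) : rat := x@_F0.

Definition primitive (p : H) : Prop := Delta p = tensor2 p One + tensor2 One p.

Definition prims (ps : seq H) : Prop := forall q, q \in ps -> primitive q.

Definition tmap (Phi : H -> H) (y : H2) : H2 :=
  \sum_(k <- msupp y) y@_k *: tensor2 (Phi << k.1 >>) (Phi << k.2 >>).

Definition lin (Phi : H -> H) : Prop :=
  forall (a : rat) (x y : H), Phi (a *: x + y) = a *: Phi x + Phi y.

Definition coalg_endo (Phi : H -> H) : Prop :=
  [/\ lin Phi, (forall x, Delta (Phi x) = tmap Phi (Delta x))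
     & (forall x, eps (Phi x) = eps x)].

Fixpoint wt (t : rtree) : nat := let: Node cs := t in (sumn (map wt cs)).+1.
Definition weightF (f : seq rtree) : nat := sumn (map wt f).

Fixpoint graftT (M : seq rtree) (t : rtree) : seq rtree :=
  match t with
  | Node cs =>
      Node (M ++ cs) ::
      map Node ((fix gl (l : seq rtree) : seq (seq rtree) :=
                   match l with
                   | [::] => [::]
                   | c :: l' => [seq g :: l' | g <- graftT M c] ++
                                [seq c :: r | r <- gl l']
                   end) cs)
  end.

Fixpoint graftF (M : seq rtree) (l : seq rtree) : seq (seq rtree) :=
  match l with
  | [::] => [::]
  | c :: l' => [seq g :: l' | g <- graftT M c] ++ [seq c :: r | r <- graftF M l']
  end.

Definition topB (M N : forest) : H :=
  if val N == [::] then 0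
  else (weightF (val N))%:R^-1 *: \sum_(g <- graftF (val M) (val N)) << mkF g >>.

Definition top (x y : H) : H := bilin topB x y.

(* topn [:: q1; q2; ...; qi] = (..(q1 T q2) T ..) T qi, i.e. with
   [:: p_i; ...; p_1] it is p_i T ... T p_1 = F_i(p_i (x) ... (x) p_1). *)
Definition topn (s : seq H) : H :=
  match s with [::] => One | x :: s' => foldl top x s' end.

(* compositions: comps m n = sequences of positive integers summing to n
   (with at most m parts); comps n n = all compositions of n *)
Fixpoint comps (m n : nat) : seq (seq nat) :=
  match m with
  | 0 => if n == 0%N then [:: [::]] else [::]
  | m'.+1 => if n == 0%N then [:: [::]]
             else flatten [seq [seq a :: c | c <- comps m' (n - a)] | a <- iota 1 n]
  end.

Fixpoint split_by (T : Type) (a : seq nat) (s : seq T) : seq (seq T) :=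
  match a with
  | [::] => [::]
  | x :: a' => take x s :: split_by a' (drop x s)
  end.

(* A family u_i : Prim^{(x) i} -> Prim (i >= 1), given (universal property of
   the tensor product) by its values u i [:: p_i; ...; p_1] on pure tensors of
   primitives p_i (x) ... (x) p_1, multilinear on primitives, valued in Prim. *)
Definition ufamily := nat -> seq H -> H.

Definition admissible_family (u : ufamily) : Prop :=
  forall i : nat, (0 < i)%N ->
    (forall ps, size ps = i -> prims ps -> primitive (u i ps)) /\
    (forall ps (j : nat) (a : rat) (x y : H),
        size ps = i -> (j < i)%N -> prims ps -> primitive x -> primitive y ->
        u i (set_nth 0 ps j (a *: x + y)) =
          a *: u i (set_nth 0 ps j x) + u i (set_nth 0 ps j y)).

Definition PhiRHS (u : ufamily) (ps : seq H) : H :=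
  let n := size ps in
  \sum_(1 <= k < n.+1)
    \sum_(a <- comps n n | size a == k)
      topn [seq u r.1 r.2 | r <- zip a (split_by a ps)].

Definition is_Phi (u : ufamily) (Phi : H -> H) : Prop :=
  [/\ lin Phi, Phi One = One
     & forall ps : seq H, (0 < size ps)%N -> prims ps ->
         Phi (topn ps) = PhiRHS u ps].

(* Main.v *)
Require Import Defs.
From HB Require Import structures.
From mathcomp Require Import all_boot all_order all_algebra.
From mathcomp Require Import finmap zify.
From mathcomp.multinomials Require Import monalg.

Set Implicit Arguments.
Unset Strict Implicit.
Unset Printing Implicit Defensive.

Import GRing.Theory Num.Theory.
Local Open Scope ring_scope.

(* Every x in H_R satisfies x = eps(x) 1 + sum x' T pi(x''), where pi is defined
   by this equation, recursively on the weight, and takes primitive values: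
   grafting onto a primitive element p satisfies
   Delta (x T p) = (x T p) (x) 1 + sum x' (x) (x'' T p), which together with
   coassociativity gives Delta (pi x) = pi x (x) 1 + 1 (x) pi x.  It follows that
   the p_n T ... T p_1 span H_R, that Delta deconcatenates them, and that pi kills
   them for n > 1.  A coalgebra endomorphism Phi with U = pi o Phi then satisfies
   Phi(x) = eps(x) 1 + sum Phi(x') T U(x''), and conversely every primitive-valued
   U with U(1) = 0 defines a coalgebra endomorphism by this recursion.  Unfolding
   the recursion on p_n T ... T p_1 yields the sum over compositions, with
   u_n (p_n (x) ... (x) p_1) = U (p_n T ... T p_1).

   The coproduct formula is checked on planar forests, whose sums over cuts and
   graftings only depend on isomorphism classes. *)

(** * Planar forests and their isomorphism classes *)

(** No tensor power is formed: a family is a function on lists, multilinear in primitive entries,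
    and coproducts are tested against bilinear maps. Prescribing a linear map on the products p_n T
    ... T p_1 then raises a question of well-definedness. It is met by iterating x = eps(x) 1 + sum
    x' T pi(x''): U sends x to the sum over k of u_k at the k-tuples of pi-values of its iterated
    coproduct, and pi(x T p) = eps(x) p shows that its value on an iterated product is the
    prescribed one.

    The equation can be solved for pi because 1 T y = y - eps(y) 1, which is the effect of the
    factor 1/weight. That factor is not compatible with cuts, whose parts have smaller weight. It is
    moved into the right argument of T, where it preserves primitive elements because the coproduct
    is graded.

    The converse also needs Phi(1) = 1; this holds because 1 is the only grouplike element of counit
    1. *)

Lemma rtree_forest_ind (P : rtree -> Prop) (Q : seq rtree -> Prop) :
  Q [::] -> (forall t l, P t -> Q l -> Q (t :: l)) ->
  (forall cs, Q cs -> P (Node cs)) -> (forall t, P t) /\ (forall l, Q l).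
Proof.
move=> Q0 Qcons PN.
have PT : forall t, P t.
  fix IH 1 => -[cs]; apply: PN.
  by elim: cs => [|c cs IHcs]; [exact: Q0 | apply: Qcons; [exact: IH | exact: IHcs]].
by split=> // l; elim: l => // t l; apply: Qcons.
Qed.

Lemma rtree_le_total : total rtree_le.
Proof. by move=> x y; rewrite /rtree_le leq_total. Qed.

Lemma rtree_le_trans : transitive rtree_le.
Proof. by move=> x y z; rewrite /rtree_le; apply: leq_trans. Qed.

Lemma rtree_le_anti : antisymmetric rtree_le.
Proof.
move=> x y; rewrite /rtree_le -eqn_leq => /eqP e.
by apply: (pcan_inj (@choice.pickleK rtree)).
Qed.

Lemma sort_perm (l l' : seq rtree) :
  perm_eq l l' -> sort rtree_le l = sort rtree_le l'.
Proof. by move/(perm_sortP rtree_le_total rtree_le_trans rtree_le_anti). Qed.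

Lemma cforest_perm (l l' : seq rtree) : perm_eq l l' -> cforest l = cforest l'.
Proof. by move=> e; apply: sort_perm; apply: perm_map. Qed.

Lemma map_canonK :
  (forall t, canon (canon t) = canon t) /\
  (forall l, map canon (map canon l) = map canon l).
Proof.
apply: rtree_forest_ind => //= [t l -> -> //|cs IH].
congr Node; apply: sort_perm; rewrite -[X in perm_eq _ X]IH.
by apply: perm_map; rewrite perm_sort.
Qed.

Lemma cforestK l : cforest (cforest l) = cforest l.
Proof.
rewrite /cforest; apply: sort_perm; rewrite -[X in perm_eq _ X](map_canonK.2).
by apply: perm_map; rewrite perm_sort.
Qed.

Lemma perm_cforest l : perm_eq (cforest l) (map canon l).
Proof. by rewrite /cforest perm_sort. Qed.

Lemma cforest_cat l1 l2 l1' l2' :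
  cforest l1 = cforest l1' -> cforest l2 = cforest l2' ->
  cforest (l1 ++ l2) = cforest (l1' ++ l2').
Proof.
move=> e1 e2; apply: sort_perm; rewrite !map_cat perm_cat //.
  by rewrite -(permPr (perm_cforest l1')) -e1 perm_sym perm_cforest.
by rewrite -(permPr (perm_cforest l2')) -e2 perm_sym perm_cforest.
Qed.

Lemma cforest_node l l' :
  cforest l = cforest l' -> cforest [:: Node l] = cforest [:: Node l'].
Proof. by rewrite {3 4}/cforest /= => e; congr [:: Node _]. Qed.

Lemma cforest_cons t t' l l' :
  cforest [:: t] = cforest [:: t'] -> cforest l = cforest l' ->
  cforest (t :: l) = cforest (t' :: l').
Proof. by move=> e1 e2; rewrite -cat1s -[t' :: l']cat1s; apply: cforest_cat. Qed.

Lemma cforest_swap t l1 l2 : cforest (t :: l1 ++ l2) = cforest (l1 ++ t :: l2).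
Proof. by apply: cforest_perm; rewrite -cat1s -[t :: l2]cat1s perm_catCA. Qed.

Lemma val_mkF l : val (mkF l) = cforest l.
Proof. by rewrite /mkF insubdK // -topredE /= cforestK. Qed.

Lemma mkF_eq l l' : cforest l = cforest l' -> mkF l = mkF l'.
Proof. by move=> e; apply: val_inj; rewrite !val_mkF. Qed.

Lemma cforest_val (f : forest) : cforest (val f) = val f.
Proof. exact/eqP/(valP f). Qed.

Lemma mkF_val (f : forest) : mkF (val f) = f.
Proof. by apply: val_inj; rewrite val_mkF cforest_val. Qed.

Lemma mkF_nil : mkF [::] = F0.
Proof. by apply: val_inj; rewrite val_mkF. Qed.

(* Sorting and canonicalizing are generated by swaps, concatenation and root
   addition, so a relation stable under these contains [l ~ cforest l]. *)
Lemma cforest_rel (RT : rtree -> rtree -> Prop) (R : seq rtree -> seq rtree -> Prop) :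
  (forall l, R l l) -> (forall t, RT t t) ->
  (forall l1 l2 l3, R l1 l2 -> R l2 l3 -> R l1 l3) ->
  (forall t t' l l', RT t t' -> R l l' -> R (t :: l) (t' :: l')) ->
  (forall l l', R l l' -> RT (Node l) (Node l')) ->
  (forall t l1 l2, R (t :: l1 ++ l2) (l1 ++ t :: l2)) ->
  forall l, R l (cforest l).
Proof.
move=> R0 RT0 Rtr Rcons RN Rsw.
have Rperm l l' : perm_eq l l' -> R l l'.
  elim: l l' => [|t l IH] l' e; first by move: e; rewrite perm_sym => /perm_nilP ->; apply: R0.
  have tl' : t \in l' by rewrite -(perm_mem e) mem_head.
  case/splitPr: tl' e => l1 l2 e; apply: Rtr (Rsw _ _ _); apply: Rcons => //.
  apply: IH; rewrite -(perm_cons t); apply: perm_trans e _.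
  by rewrite -cat_cons perm_catC /= perm_cons perm_catC.
have [_ Rcanon] : (forall t, RT t (canon t)) /\ (forall l, R l (map canon l)).
  apply: rtree_forest_ind => //= [t l pt ql|cs ql]; first exact: Rcons.
  by apply: RN; apply: Rtr ql _; apply: Rperm; rewrite perm_sym perm_sort.
move=> l; apply: Rtr (Rcanon l) _; apply: Rperm.
by rewrite perm_sym; apply: perm_cforest.
Qed.

(** * Planar cuts *)

(* Each pair is (pruned part, part containing the roots); the empty and the
   total cut of each tree are included. *)
Fixpoint cutT (t : rtree) : seq (seq rtree * seq rtree) :=
  let: Node cs := t in
  ([:: t], [::]) ::
  [seq (c.1, [:: Node c.2]) | c <-
    (fix cl (l : seq rtree) : seq (seq rtree * seq rtree) :=
      match l with
      | [::] => [:: ([::], [::])]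
      | t' :: l' => [seq (c.1 ++ d.1, c.2 ++ d.2) | c <- cutT t', d <- cl l']
      end) cs].

Fixpoint cutF (l : seq rtree) : seq (seq rtree * seq rtree) :=
  match l with
  | [::] => [:: ([::], [::])]
  | t :: l' => [seq (c.1 ++ d.1, c.2 ++ d.2) | c <- cutT t, d <- cutF l']
  end.

Lemma cutT_node cs :
  cutT (Node cs) =
    ([:: Node cs], [::]) :: [seq (c.1, [:: Node c.2]) | c <- cutF cs].
Proof. by []. Qed.

Lemma graftT_node M cs :
  graftT M (Node cs) = Node (M ++ cs) :: map Node (graftF M cs).
Proof.
rewrite /=; congr (_ :: map _ _).
by elim: cs => //= c cs ->.
Qed.

(** * Coassociativity, counit and grafting for sums over planar cuts *)

Section PlanarSums.
Variable V : nmodType.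
Implicit Types (phi : seq rtree -> seq rtree -> V) (psi : seq rtree -> V).

Lemma big_cutT_node cs phi :
  \sum_(c <- cutT (Node cs)) phi c.1 c.2 =
  phi [:: Node cs] [::] + \sum_(c <- cutF cs) phi c.1 [:: Node c.2].
Proof. by rewrite cutT_node big_cons big_map. Qed.

Lemma big_cutF_nil phi : \sum_(c <- cutF [::]) phi c.1 c.2 = phi [::] [::].
Proof. by rewrite big_seq1. Qed.

Lemma big_cutF_cons t l phi :
  \sum_(c <- cutF (t :: l)) phi c.1 c.2 =
  \sum_(c <- cutT t) \sum_(d <- cutF l) phi (c.1 ++ d.1) (c.2 ++ d.2).
Proof. by rewrite /= big_allpairs_dep. Qed.

Lemma big_cutF1 t phi :
  \sum_(c <- cutF [:: t]) phi c.1 c.2 = \sum_(c <- cutT t) phi c.1 c.2.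
Proof.
rewrite big_cutF_cons; apply: eq_bigr => c _.
by rewrite (big_cutF_nil (fun p r => phi (c.1 ++ p) (c.2 ++ r))) !cats0.
Qed.

Lemma big_cutF_cat l1 l2 phi :
  \sum_(c <- cutF (l1 ++ l2)) phi c.1 c.2 =
  \sum_(c <- cutF l1) \sum_(d <- cutF l2) phi (c.1 ++ d.1) (c.2 ++ d.2).
Proof.
elim: l1 phi => [|t l1 IH] phi /=.
  by rewrite (big_cutF_nil (fun p r => \sum_(d <- cutF l2) phi (p ++ d.1) (r ++ d.2))).
rewrite !big_allpairs_dep; apply: eq_bigr => c _.
rewrite (IH (fun p r => phi (c.1 ++ p) (c.2 ++ r))); apply: eq_bigr => d _.
by apply: eq_bigr => e _ /=; rewrite !catA.
Qed.

(** Both sides enumerate the divisions of the forest into three layers by two nested cuts. As [phi]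
    is arbitrary, this is an equality of multisets of triples. *)
Lemma cut_coassoc :
  (forall t (phi : seq rtree -> seq rtree -> seq rtree -> V),
    \sum_(c <- cutT t) \sum_(d <- cutF c.1) phi d.1 d.2 c.2 =
    \sum_(c <- cutT t) \sum_(d <- cutF c.2) phi c.1 d.1 d.2) /\
  (forall l (phi : seq rtree -> seq rtree -> seq rtree -> V),
    \sum_(c <- cutF l) \sum_(d <- cutF c.1) phi d.1 d.2 c.2 =
    \sum_(c <- cutF l) \sum_(d <- cutF c.2) phi c.1 d.1 d.2).
Proof.
apply: rtree_forest_ind => [phi|t l IHt IHl phi|cs IH phi].
- by rewrite !big_seq1.
- rewrite (big_cutF_cons _ _ (fun p r => \sum_(d <- cutF p) phi d.1 d.2 r)).
  rewrite (big_cutF_cons _ _ (fun p r => \sum_(d <- cutF r) phi p d.1 d.2)).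
  under eq_bigr => c _ do under eq_bigr => d _ do
    rewrite (big_cutF_cat _ _ (fun a b => phi a b _)).
  under [RHS]eq_bigr => c _ do under eq_bigr => d _ do
    rewrite (big_cutF_cat _ _ (fun a b => phi _ a b)).
  under eq_bigr => c _ do rewrite exchange_big /=.
  rewrite (IHt (fun a b r => \sum_(d <- cutF l) \sum_(e <- cutF d.1)
     phi (a ++ e.1) (b ++ e.2) (r ++ d.2))).
  apply: eq_bigr => c _; rewrite [RHS]exchange_big /=; apply: eq_bigr => d _.
  exact: (IHl (fun a b r => phi (c.1 ++ a) (d.1 ++ b) (d.2 ++ r))).
(* The terms are sorted by the layer that contains the root. *)
- rewrite (big_cutT_node cs (fun p r => \sum_(d <- cutF p) phi d.1 d.2 r)).
  rewrite (big_cutT_node cs (fun p r => \sum_(d <- cutF r) phi p d.1 d.2)).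
  rewrite (big_cutF1 (Node cs) (fun a b => phi a b [::])).
  rewrite (big_cutT_node cs (fun a b => phi a b [::])) -addrA big_cutF_nil.
  congr (_ + _); rewrite (IH (fun a b r => phi a b [:: Node r])) -big_split /=.
  apply: eq_bigr => c _; rewrite (big_cutF1 (Node c.2) (fun a b => phi c.1 a b)).
  by rewrite (big_cutT_node c.2 (fun a b => phi c.1 a b)).
Qed.

Lemma cut_counitl :
  (forall t phi, \sum_(c <- cutT t | nilp c.1) phi c.1 c.2 = phi [::] [:: t]) /\
  (forall l phi, \sum_(c <- cutF l | nilp c.1) phi c.1 c.2 = phi [::] l).
Proof.
apply: rtree_forest_ind => [phi|t l IHt IHl phi|cs IH phi].
- by rewrite /= big_mkcond big_seq1.
- rewrite big_mkcond /= big_allpairs_dep /=.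
  under eq_bigr => c _ do under eq_bigr => d _ do rewrite cat_nilp.
  have E c : \sum_(d <- cutF l) (if nilp c.1 && nilp d.1 then phi (c.1 ++ d.1) (c.2 ++ d.2) else 0)
     = if nilp c.1 then phi c.1 (c.2 ++ l) else 0.
    case: ifP => /= _; last by rewrite big1.
    by rewrite -big_mkcond (IHl (fun a b => phi (c.1 ++ a) (c.2 ++ b))) cats0.
  under eq_bigr => c _ do rewrite E.
  by rewrite -big_mkcond (IHt (fun a b => phi a (b ++ l))).
- by rewrite cutT_node big_cons /= big_map /= (IH (fun a b => phi a [:: Node b])).
Qed.

(** A cut below the root keeps the root in the trunk, so only the total cut leaves no trunk. *)
Lemma cut_counitr :
  (forall t phi, \sum_(c <- cutT t | nilp c.2) phi c.1 c.2 = phi [:: t] [::]) /\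
  (forall l phi, \sum_(c <- cutF l | nilp c.2) phi c.1 c.2 = phi l [::]).
Proof.
apply: rtree_forest_ind => [phi|t l IHt IHl phi|cs IH phi].
- by rewrite /= big_mkcond big_seq1.
- rewrite big_mkcond /= big_allpairs_dep /=.
  under eq_bigr => c _ do under eq_bigr => d _ do rewrite cat_nilp.
  have E c : \sum_(d <- cutF l) (if nilp c.2 && nilp d.2 then phi (c.1 ++ d.1) (c.2 ++ d.2) else 0)
     = if nilp c.2 then phi (c.1 ++ l) c.2 else 0.
    case: ifP => /= _; last by rewrite big1.
    by rewrite -big_mkcond (IHl (fun a b => phi (c.1 ++ a) (c.2 ++ b))) cats0.
  under eq_bigr => c _ do rewrite E.
  by rewrite -big_mkcond (IHt (fun a b => phi (a ++ l) b)).
- by rewrite cutT_node big_cons /= big_map /= big_pred0_eq addr0.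
Qed.

Lemma big_graftT_node M cs psi :
  \sum_(g <- graftT M (Node cs)) psi [:: g] =
  psi [:: Node (M ++ cs)] + \sum_(h <- graftF M cs) psi [:: Node h].
Proof. by rewrite graftT_node big_cons big_map. Qed.

Lemma big_graftF_cons M t l psi :
  \sum_(g <- graftF M (t :: l)) psi g =
  \sum_(g <- graftT M t) psi (g :: l) + \sum_(h <- graftF M l) psi (t :: h).
Proof. by rewrite /= big_cat !big_map. Qed.

Lemma big_graftF1 M t psi :
  \sum_(g <- graftF M [:: t]) psi g = \sum_(g <- graftT M t) psi [:: g].
Proof. by rewrite big_graftF_cons /= big_nil addr0. Qed.

Lemma big_graftF_cat M l1 l2 psi :
  \sum_(g <- graftF M (l1 ++ l2)) psi g =
  \sum_(g <- graftF M l1) psi (g ++ l2) + \sum_(g <- graftF M l2) psi (l1 ++ g).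
Proof.
elim: l1 psi => [|t l1 IH] psi; first by rewrite /= big_nil add0r.
rewrite cat_cons big_graftF_cons (IH (fun h => psi (t :: h))) addrA.
by rewrite (big_graftF_cons _ _ _ (fun g => psi (g ++ l2))).
Qed.

Definition class_fun psi := forall l, psi l = psi (cforest l).
Definition class_fun2 phi := forall l m, phi l m = phi (cforest l) (cforest m).

Lemma class_fun_eq psi l l' : class_fun psi -> cforest l = cforest l' -> psi l = psi l'.
Proof. by move=> h e; rewrite (h l) e -h. Qed.

Lemma class_fun2_eq phi l l' m m' : class_fun2 phi ->
  cforest l = cforest l' -> cforest m = cforest m' -> phi l m = phi l' m'.
Proof. by move=> h e e'; rewrite (h l) e e' -h. Qed.

(** A cut of a grafted forest restricts to a cut [d] of the target. If the grafting vertex is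
    pruned, [M] goes with it entirely. If it stays in the trunk, the cut also induces a cut [c] of
    [M], whose trunk is grafted onto [d.2]. Pruned trees come in different orders on the two sides,
    hence the class functions. *)
Lemma cut_graft :
  (forall t M phi, class_fun2 phi ->
    \sum_(g <- graftT M t) \sum_(c <- cutT g) phi c.1 c.2 =
    \sum_(d <- cutT t) \sum_(g <- graftF M d.1) phi g d.2 +
    \sum_(c <- cutF M) \sum_(d <- cutT t) \sum_(g <- graftF c.2 d.2) phi (c.1 ++ d.1) g) /\
  (forall l M phi, class_fun2 phi ->
    \sum_(g <- graftF M l) \sum_(c <- cutF g) phi c.1 c.2 =
    \sum_(d <- cutF l) \sum_(g <- graftF M d.1) phi g d.2 +
    \sum_(c <- cutF M) \sum_(d <- cutF l) \sum_(g <- graftF c.2 d.2) phi (c.1 ++ d.1) g).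
Proof.
apply: rtree_forest_ind => [M phi _|t l IHt IHl M phi hphi|cs IH M phi hphi].
- rewrite big_nil big_seq1 big_nil add0r big1 // => c _.
  by rewrite big_seq1 big_nil.
- rewrite (big_graftF_cons _ _ _ (fun g => \sum_(c <- cutF g) phi c.1 c.2)).
  under eq_bigr => g _ do rewrite big_cutF_cons.
  under [X in _ + X]eq_bigr => g _ do rewrite big_cutF_cons.
  rewrite [X in _ + X]exchange_big /=.
  rewrite (IHt M (fun a b => \sum_(d <- cutF l) phi (a ++ d.1) (b ++ d.2))); last first.
    move=> a b; apply: eq_bigr => d _; apply: class_fun2_eq => //;
    by apply: cforest_cat; rewrite ?cforestK.
  under [X in _ + X = _]eq_bigr => c _.
    rewrite (IHl M (fun a b => phi (c.1 ++ a) (c.2 ++ b))); last first.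
      by move=> a b; apply: class_fun2_eq => //; apply: cforest_cat; rewrite ?cforestK.
  over.
  rewrite big_split /=.
  rewrite (big_cutF_cons _ _ (fun p r => \sum_(g <- graftF M p) phi g r)).
  under [X in _ = _ + X]eq_bigr => c _ do
    rewrite (big_cutF_cons _ _ (fun p r => \sum_(g <- graftF c.2 r) phi (c.1 ++ p) g)).
  under [X in _ = X + _]eq_bigr => c _ do under eq_bigr => d _ do rewrite big_graftF_cat.
  under [X in _ = X + _]eq_bigr => c _ do rewrite big_split exchange_big /=.
  under [X in _ = _ + X]eq_bigr => c _ do under eq_bigr => d _ do
    under eq_bigr => e _ do rewrite big_graftF_cat.
  under [X in _ = _ + X]eq_bigr => c _ do under eq_bigr => d _ do
    rewrite big_split exchange_big /=.
  under [X in _ = _ + X]eq_bigr => c _ do rewrite big_split /=.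
  rewrite !big_split /= addrACA; congr (_ + _ + (_ + _)).
    apply: eq_bigr => c _; apply: eq_bigr => d _; apply: eq_bigr => g _.
    by apply: eq_bigr => e _; rewrite !catA.
  (* The trees pruned from [M] have to move past those pruned from [t]. *)
  rewrite exchange_big /=; apply: eq_bigr => c _; apply: eq_bigr => d _.
  apply: eq_bigr => e _; apply: eq_bigr => g _; apply: class_fun2_eq => //.
  by apply: cforest_perm; rewrite perm_catCA.
(* Grafting at the root gives [Node (M ++ cs)]. Its total cut is the graft onto the pruned
   [Node cs]; its other cuts are pairs of a cut of [M] and a cut of [cs], with trunks joined at the
   root. *)
- rewrite graftT_node big_cons big_map big_cutT_node.
  under [X in _ + X = _]eq_bigr => h _ do rewrite big_cutT_node.
  rewrite big_split /= (IH M (fun a b => phi a [:: Node b])); last first.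
    by move=> a b; apply: class_fun2_eq; rewrite ?cforestK //; apply: cforest_node; rewrite cforestK.
  rewrite (big_cutF_cat M cs (fun a b => phi a [:: Node b])).
  rewrite (big_cutT_node cs (fun p r => \sum_(g <- graftF M p) phi g r)).
  rewrite (big_graftF1 _ _ (fun g => phi g [::])) (big_graftT_node M cs (fun g => phi g [::])).
  under [X in _ = _ + X]eq_bigr => c _ do
    rewrite (big_cutT_node cs (fun p r => \sum_(g <- graftF c.2 r) phi (c.1 ++ p) g)) big_nil add0r.
  under [X in _ = _ + X]eq_bigr => c _ do under eq_bigr => d _ do
    rewrite (big_graftF1 _ _ (fun g => phi _ g)) (big_graftT_node _ _ (fun g => phi _ g)).
  under [X in _ = _ + X]eq_bigr => c _ do rewrite big_split /=.
  rewrite big_split /= -!addrA; congr (_ + _); rewrite addrCA; congr (_ + _).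
  by rewrite addrCA.
Qed.

(** Having equal sums for every class function is stable under the moves that generate sorting and
    canonicalizing. The relations also record equality of classes, which the total-cut term [phi
    [:: Node l] [::]] requires. *)
Lemma big_cut_class l phi : class_fun2 phi ->
  \sum_(c <- cutF (cforest l)) phi c.1 c.2 = \sum_(c <- cutF l) phi c.1 c.2.
Proof.
pose RT t t' := cforest [:: t] = cforest [:: t'] /\ forall phi, class_fun2 phi ->
  \sum_(c <- cutT t) phi c.1 c.2 = \sum_(c <- cutT t') phi c.1 c.2.
pose R l l' := cforest l = cforest l' /\ forall phi, class_fun2 phi ->
  \sum_(c <- cutF l) phi c.1 c.2 = \sum_(c <- cutF l') phi c.1 c.2.
suff [_ h] : R l (cforest l) by move/h.
apply: (@cforest_rel RT R) => // {l phi}.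
- by move=> l1 l2 l3 [e12 h12] [e23 h23]; split=> [|phi hp]; rewrite ?e12 // h12 // h23.
- move=> t t' l l' [e1 h1] [e2 h2]; split=> [|phi hp]; first exact: cforest_cons.
  rewrite !big_cutF_cons.
  rewrite (h1 (fun a b => \sum_(d <- cutF l) phi (a ++ d.1) (b ++ d.2))); last first.
    move=> a b; apply: eq_bigr => d _; apply: class_fun2_eq => //;
    by apply: cforest_cat; rewrite ?cforestK.
  apply: eq_bigr => c _; apply: (h2 (fun a b => phi (c.1 ++ a) (c.2 ++ b))).
  by move=> a b; apply: class_fun2_eq => //; apply: cforest_cat; rewrite ?cforestK.
- move=> l l' [e h]; split=> [|phi hp]; first exact: cforest_node.
  rewrite !big_cutT_node; congr (_ + _).
    by apply: class_fun2_eq => //; apply: cforest_node.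
  apply: (h (fun a b => phi a [:: Node b])) => a b.
  by apply: class_fun2_eq; rewrite ?cforestK //; apply: cforest_node; rewrite cforestK.
- move=> t l1 l2; split=> [|phi hp].
    exact: cforest_swap.
  rewrite big_cutF_cat big_cutF_cons.
  under eq_bigr => c _ do rewrite (big_cutF_cat _ _ (fun p r => phi (c.1 ++ p) (c.2 ++ r))).
  under [RHS]eq_bigr => c _ do rewrite (big_cutF_cons _ _ (fun p r => phi (c.1 ++ p) (c.2 ++ r))).
  rewrite exchange_big /=; apply: eq_bigr => c _; apply: eq_bigr => d _.
  apply: eq_bigr => e _; apply: class_fun2_eq => //;
  by apply: cforest_perm; rewrite perm_catCA.
Qed.

Lemma big_graft_classr M l psi : class_fun psi ->
  \sum_(g <- graftF M (cforest l)) psi g = \sum_(g <- graftF M l) psi g.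
Proof.
pose RT t t' := cforest [:: t] = cforest [:: t'] /\ forall psi, class_fun psi ->
  \sum_(g <- graftT M t) psi [:: g] = \sum_(g <- graftT M t') psi [:: g].
pose R l l' := cforest l = cforest l' /\ forall psi, class_fun psi ->
  \sum_(g <- graftF M l) psi g = \sum_(g <- graftF M l') psi g.
suff [_ h] : R l (cforest l) by move/h.
apply: (@cforest_rel RT R) => // {l psi}.
- by move=> l1 l2 l3 [e12 h12] [e23 h23]; split=> [|psi hp]; rewrite ?e12 // h12 // h23.
- move=> t t' l l' [e1 h1] [e2 h2]; split=> [|psi hp]; first exact: cforest_cons.
  rewrite !big_graftF_cons; congr (_ + _); last first.
    rewrite (h2 (fun h => psi (t :: h))); last first.
      by move=> h; apply: class_fun_eq => //; apply: cforest_cons; rewrite ?cforestK.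
    by apply: eq_bigr => g _; apply: class_fun_eq => //; apply: cforest_cons.
  rewrite (h1 (fun g => psi (g ++ l))); last first.
    by move=> h; apply: class_fun_eq => //; apply: cforest_cat; rewrite ?cforestK.
  by apply: eq_bigr => g _; apply: class_fun_eq => //; apply: cforest_cons.
- move=> l l' [e h]; split=> [|psi hp]; first exact: cforest_node.
  rewrite !big_graftT_node; congr (_ + _).
    by apply: class_fun_eq => //; apply: cforest_node; apply: cforest_cat.
  apply: (h (fun a => psi [:: Node a])) => a.
  by apply: class_fun_eq => //; apply: cforest_node; rewrite cforestK.
- move=> t l1 l2; split=> [|psi hp].
    exact: cforest_swap.
  rewrite big_graftF_cat !big_graftF_cons (big_graftF_cat _ _ _ (fun h => psi (t :: h))).
  rewrite addrCA.
  congr (_ + (_ + _)); apply: eq_bigr => g _; apply: class_fun_eq => //;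
  exact: cforest_swap.
Qed.

(** [M] is only ever prepended to lists of children, so its class suffices at each vertex. *)
Lemma big_graft_classl M M' : cforest M = cforest M' ->
  (forall t psi, class_fun psi ->
    \sum_(g <- graftT M t) psi [:: g] = \sum_(g <- graftT M' t) psi [:: g]) /\
  (forall l psi, class_fun psi ->
    \sum_(g <- graftF M l) psi g = \sum_(g <- graftF M' l) psi g).
Proof.
move=> eM; apply: rtree_forest_ind => [//|t l IHt IHl psi hp|cs IH psi hp].
- rewrite !big_graftF_cons (IHl (fun h => psi (t :: h))); last first.
    by move=> h; apply: class_fun_eq => //; apply: cforest_cons; rewrite ?cforestK.
  congr (_ + _); apply: (IHt (fun g => psi (g ++ l))) => h.
  by apply: class_fun_eq => //; apply: cforest_cat; rewrite ?cforestK.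
- rewrite !big_graftT_node; congr (_ + _).
    by apply: class_fun_eq => //; apply: cforest_node; apply: cforest_cat.
  apply: (IH (fun a => psi [:: Node a])) => a.
  by apply: class_fun_eq => //; apply: cforest_node; rewrite cforestK.
Qed.

End PlanarSums.

(** * Linear extension *)

Definition ext (K : choiceType) (V : lmodType rat) (phi : K -> V)
  (x : {malg rat[K]}) : V := \sum_(k <- msupp x) x@_k *: phi k.

Section LinearExtension.
Variables (K : choiceType) (V : lmodType rat).
Implicit Types (phi : K -> V) (x y : {malg rat[K]}).

Lemma ext_wider (d : {fset K}) phi x :
  (msupp x `<=` d)%fset -> ext phi x = \sum_(k <- d) x@_k *: phi k.
Proof.
move=> sub; rewrite /ext; apply: big_fset_incl => // k _ /mcoeff_outdom ->.
by rewrite scale0r.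
Qed.

Lemma ext_is_linear phi : linear (ext phi).
Proof.
move=> a x y; pose d := (msupp x `|` msupp y)%fset.
rewrite (@ext_wider d) ?(@ext_wider d _ x) ?(@ext_wider d _ y) ?fsubsetUl ?fsubsetUr //.
  rewrite scaler_sumr -big_split; apply: eq_bigr => k _ /=.
  by rewrite mcoeffD mcoeffZ scalerDl scalerA.
apply: fsubset_trans (msuppD_le _ _) _; apply: fsetSU; exact: msuppZ_le.
Qed.

HB.instance Definition _ phi :=
  GRing.isLinear.Build rat {malg rat[K]} V *:%R (ext phi) (ext_is_linear phi).

Lemma extU phi k : ext phi << k >> = phi k.
Proof.
by rewrite (@ext_wider [fset k]%fset) ?msuppU_le // big_seq_fset1 mcoeffUU scale1r.
Qed.

Lemma eq_ext phi phi' x : phi =1 phi' -> ext phi x = ext phi' x.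
Proof. by move=> e; apply: eq_bigr => k _; rewrite e. Qed.

Lemma malg_ext x : x = ext (fun k => << k >>) x.
Proof.
rewrite {1}[x]monalgE; apply: eq_bigr => k _; apply/malgP => m.
by rewrite mcoeffZ !mcoeffU mulr_natr.
Qed.

Lemma linear_ext (f : {linear {malg rat[K]} -> V}) x :
  f x = ext (fun k => f << k >>) x.
Proof. by rewrite {1}[x]malg_ext linear_sum; apply: eq_bigr => k _; rewrite linearZ. Qed.

Lemma ext_const0 x : ext (fun=> 0 : V) x = 0.
Proof. by rewrite /ext big1 // => k _; rewrite scaler0. Qed.

Lemma ext_add phi phi' x : ext (fun k => phi k + phi' k) x = ext phi x + ext phi' x.
Proof. by rewrite /ext -big_split; apply: eq_bigr => k _; rewrite scalerDr. Qed.

Lemma ext_scale a phi x : ext (fun k => a *: phi k) x = a *: ext phi x.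
Proof.
by rewrite /ext scaler_sumr; apply: eq_bigr => k _; rewrite !scalerA mulrC.
Qed.

Lemma ext_sum (I : Type) (r : seq I) (P : pred I) (F : I -> K -> V) x :
  ext (fun k => \sum_(i <- r | P i) F i k) x = \sum_(i <- r | P i) ext (F i) x.
Proof.
rewrite /ext exchange_big; apply: eq_bigr => k _; exact: scaler_sumr.
Qed.

End LinearExtension.

Lemma ext_linear (K : choiceType) (V W : lmodType rat) (f : {linear V -> W})
  (phi : K -> V) x : f (ext phi x) = ext (fun k => f (phi k)) x.
Proof. by rewrite /ext linear_sum; apply: eq_bigr => k _; rewrite linearZ. Qed.

Lemma ext_comp (K K' : choiceType) (V : lmodType rat) (phi : K -> V)
  (psi : K' -> {malg rat[K]}) x :
  ext phi (ext psi x) = ext (fun k => ext phi (psi k)) x.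
Proof. exact: ext_linear. Qed.

Lemma ext_big (K : choiceType) (V : lmodType rat) (phi : K -> V) (I : Type)
  (r : seq I) (P : pred I) (F : I -> {malg rat[K]}) :
  ext phi (\sum_(i <- r | P i) F i) = \sum_(i <- r | P i) ext phi (F i).
Proof. exact: linear_sum. Qed.

Lemma extD (K : choiceType) (V : lmodType rat) (phi : K -> V) x y :
  ext phi (x + y) = ext phi x + ext phi y.
Proof. exact: linearD. Qed.

Lemma extZ (K : choiceType) (V : lmodType rat) (phi : K -> V) a x :
  ext phi (a *: x) = a *: ext phi x.
Proof. exact: linearZ. Qed.

Lemma ext_swap (K K' : choiceType) (V : lmodType rat) (b : K -> K' -> V) x y :
  ext (fun k => ext (b k) y) x = ext (fun m => ext (b^~ m) x) y.
Proof.
rewrite /ext; under eq_bigr => k _ do rewrite scaler_sumr.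
rewrite exchange_big /=; apply: eq_bigr => m _; rewrite scaler_sumr.
by apply: eq_bigr => k _; rewrite !scalerA mulrC.
Qed.

Section Bilinear.
Variables (K1 K2 K3 : choiceType) (b : K1 -> K2 -> {malg rat[K3]}).
Implicit Types (x : {malg rat[K1]}) (y : {malg rat[K2]}).

Lemma bilinE x y : bilin b x y = ext (fun k => ext (b k) y) x.
Proof.
rewrite /bilin /ext; apply: eq_bigr => k _; rewrite scaler_sumr.
by apply: eq_bigr => m _; rewrite scalerA.
Qed.

Lemma bilinDl x x' y : bilin b (x + x') y = bilin b x y + bilin b x' y.
Proof. by rewrite !bilinE linearD. Qed.

Lemma bilinZl a x y : bilin b (a *: x) y = a *: bilin b x y.
Proof. by rewrite !bilinE linearZ. Qed.

Lemma bilin_suml (I : Type) (r : seq I) (P : pred I) (F : I -> {malg rat[K1]}) y :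
  bilin b (\sum_(i <- r | P i) F i) y = \sum_(i <- r | P i) bilin b (F i) y.
Proof. by rewrite !bilinE linear_sum; apply: eq_bigr => i _; rewrite bilinE. Qed.

Lemma bilin_linearr x : linear (bilin b x).
Proof. by move=> a y y'; rewrite !bilinE !(ext_swap _ x) linearP. Qed.

Lemma bilinU k m : bilin b << k >> << m >> = b k m.
Proof. by rewrite bilinE !extU. Qed.

Lemma bilin_extl (V : choiceType) (phi : V -> {malg rat[K1]}) (x : {malg rat[V]}) y :
  bilin b (ext phi x) y = ext (fun k => bilin b (phi k) y) x.
Proof.
rewrite bilinE ext_linear; apply: eq_ext => k; exact/esym/bilinE.
Qed.

Lemma bilin_extr (V : choiceType) (phi : V -> {malg rat[K2]}) x (y : {malg rat[V]}) :
  bilin b x (ext phi y) = ext (fun k => bilin b x (phi k)) y.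
Proof.
rewrite bilinE ext_swap ext_linear; apply: eq_ext => k.
by rewrite bilinE ext_swap.
Qed.
End Bilinear.

HB.instance Definition _ x := GRing.isLinear.Build rat H H2 *:%R (tensor2 x)
  (bilin_linearr _ x).
HB.instance Definition _ x := GRing.isLinear.Build rat H2 H2 *:%R (mul2 x)
  (bilin_linearr _ x).
HB.instance Definition _ x := GRing.isLinear.Build rat H H *:%R (top x)
  (bilin_linearr _ x).
HB.instance Definition _ := GRing.isLinear.Build rat H H2 *:%R Delta
  (ext_is_linear DeltaB).

(** * The coproduct as a sum over planar cuts *)

(** This is [admissible_cut] with the empty set allowed. On [verts t], which contains the root
    address [[::]], the antichain made of the root alone encodes the total cut, so antichains of
    vertices match [cutT t]. *)
Definition antichain (C : seq (seq nat)) : bool :=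
  all (fun a => all (fun b => (a == b) || ~~ prefix a b) C) C.

(** The anonymous inner fixpoints of [verts] and [prune] get names so that inductions on lists of
    children can mention them. *)
Definition vertsL := fix vl (i : nat) (l : seq rtree) : seq (seq nat) :=
  match l with
  | [::] => [::]
  | c :: l' => [seq i :: a | a <- verts c] ++ vl i.+1 l'
  end.

Definition pruneL (C : seq (seq nat)) :=
  fix pl (i : nat) (l : seq rtree) : seq rtree :=
  match l with
  | [::] => [::]
  | c :: l' =>
      (if [:: i] \in C then [::]
       else [:: prune c [seq behead a | a <- C & (1 < size a)%N && (head 0%N a == i)]])
      ++ pl i.+1 l'
  end.

Lemma verts_node cs : verts (Node cs) = [::] :: vertsL 0 cs.
Proof. by []. Qed.

Lemma prune_node cs C : prune (Node cs) C = Node (pruneL C 0 cs).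
Proof. by []. Qed.

Lemma vertsL_head i l a : a \in vertsL i l -> (a != [::]) && (i <= head 0 a)%N.
Proof.
elim: l i => //= c l IH i; rewrite mem_cat => /orP[/mapP[b _ ->] /=|/IH /andP[-> /=]].
  exact: leqnn.
exact: ltnW.
Qed.

Lemma edges_node cs : edges (Node cs) = vertsL 0 cs.
Proof.
rewrite /edges verts_node /=; apply/all_filterP/allP => a /vertsL_head.
by case/andP.
Qed.

Lemma verts_edges t : verts t = [::] :: edges t.
Proof. by case: t => cs; rewrite edges_node verts_node. Qed.

Lemma subs_mem (T : eqType) (s C : seq T) a : C \in subs s -> a \in C -> a \in s.
Proof.
elim: s C => [|x s IH] C /=; first by rewrite inE => /eqP ->.
rewrite mem_cat => /orP[/IH h /h|/mapP[C' /IH h ->]]; rewrite !inE.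
  by move=> ->; rewrite orbT.
by case/orP=> [->//|/h ->]; rewrite orbT.
Qed.

Lemma subs_cons (T : Type) (x : T) s : subs (x :: s) = subs s ++ map (cons x) (subs s).
Proof. by []. Qed.

Lemma subs_map (T U : Type) (f : T -> U) s : subs (map f s) = map (map f) (subs s).
Proof. by elim: s => //= x s ->; rewrite map_cat -!map_comp. Qed.

Lemma prune_nil : (forall t, prune t [::] = t) /\ (forall l i, pruneL [::] i l = l).
Proof.
apply: rtree_forest_ind => // [t l et el i|cs el]; last by rewrite prune_node el.
by rewrite /= et el.
Qed.

Lemma antichain_cons i C : antichain [seq i :: a | a <- C] = antichain C.
Proof.
rewrite /antichain all_map; apply: eq_all => a /=; rewrite all_map.
by apply: eq_all => b /=; rewrite eqseq_cons eqxx.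
Qed.

Lemma antichain_cat C1 C2 :
  (forall a b, a \in C1 -> b \in C2 -> ~~ prefix a b && ~~ prefix b a) ->
  antichain (C1 ++ C2) = antichain C1 && antichain C2.
Proof.
move=> h; rewrite /antichain all_cat; congr andb; apply: eq_in_all => a ha;
  rewrite all_cat.
  rewrite [X in _ && X](_ : _ = true) ?andbT //; apply/allP => b hb.
  by have /andP[-> _] := h a b ha hb; rewrite orbT.
rewrite [X in X && _](_ : _ = true) //; apply/allP => b hb.
by have /andP[_ ->] := h b a hb ha; rewrite orbT.
Qed.

Lemma antichain_nil C : all (fun a => a != [::]) C -> antichain ([::] :: C) = nilp C.
Proof. by case: C => [//|[//|a b] C] _; rewrite /antichain /=. Qed.

(** Addresses are routed by their first index, and the children still to come have indices above
    [i]. *)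
Lemma pruneL_cat i C1 C2 l :
  (forall a, a \in C1 -> head 0%N a <= i)%N -> pruneL (C1 ++ C2) i.+1 l = pruneL C2 i.+1 l.
Proof.
elim: l i => //= c l IH i hC; congr (_ ++ _); last first.
  by apply: IH => a /hC /leqW.
rewrite mem_cat (_ : [:: i.+1] \in C1 = false) /=; last first.
  by apply/negP => /hC /=; rewrite ltnn.
rewrite filter_cat (_ : filter _ C1 = [::]) //; apply/eqP; rewrite -size_eq0 size_filter.
rewrite -leqn0 leqNgt -has_count; apply/hasPn => a /hC ha.
by rewrite negb_and orbC neq_ltn ltnS ha.
Qed.

Lemma pruneL_cons i C1 C2 c l :
  (forall a, a \in C2 -> i < head 0%N a)%N ->
  pruneL ([seq i :: a | a <- C1] ++ C2) i (c :: l) =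
  (if [::] \in C1 then [::] else [:: prune c C1]) ++ pruneL C2 i.+1 l.
Proof.
move=> h2; rewrite /= pruneL_cat; last by move=> a /mapP[b _ ->].
congr (_ ++ _); rewrite mem_cat (_ : [:: i] \in C2 = false) ?orbF; last first.
  by apply/negP => /h2 /=; rewrite ltnn.
rewrite mem_map; last by move=> a b [].
case: ifPn => // n0; rewrite filter_cat [X in _ ++ X](_ : _ = [::]) ?cats0; last first.
  apply/eqP; rewrite -size_eq0 size_filter -leqn0 leqNgt -has_count.
  by apply/hasPn => a /h2 ha; rewrite negb_and orbC neq_ltn ha orbT.
congr [:: prune c _]; elim: C1 n0 => //= a C1 IH; rewrite inE negb_or => /andP[na n0].
by case: a na => // x a _ /=; rewrite eqxx /= IH.
Qed.

Section CutSum.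
Variable V : nmodType.

Lemma big_subs_cat (T : Type) (s1 s2 : seq T) (F : seq T -> V) :
  \sum_(C <- subs (s1 ++ s2)) F C =
  \sum_(C1 <- subs s1) \sum_(C2 <- subs s2) F (C1 ++ C2).
Proof.
elim: s1 F => [|x s1 IH] F /=; first by rewrite big_seq1.
by rewrite !big_cat !big_map IH (IH (fun C => F (x :: C))).
Qed.

Lemma big_subs_nil (T : Type) (s : seq T) (F : seq T -> V) :
  \sum_(C <- subs s | nilp C) F C = F [::].
Proof.
elim: s => [|x s IH] /=; first by rewrite big_mkcond big_seq1.
by rewrite big_cat IH big_map /= big_pred0 //= addr0.
Qed.

(** Passage from cuts as sets of addresses to recursive planar cuts: an antichain in a list of trees
    is one antichain per tree. The prefix [pre] is needed because [subtree] counts children from the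
    start of the node, some of which the induction has already consumed. *)
Lemma big_antichain :
  (forall t (phi : seq rtree -> seq rtree -> V),
    \sum_(C <- subs (verts t) | antichain C)
       phi (map (subtree t) C) (if [::] \in C then [::] else [:: prune t C]) =
    \sum_(c <- cutT t) phi c.1 c.2) /\
  (forall l pre (phi : seq rtree -> seq rtree -> V),
    \sum_(C <- subs (vertsL (size pre) l) | antichain C)
       phi (map (subtree (Node (pre ++ l))) C) (pruneL C (size pre) l) =
    \sum_(c <- cutF l) phi c.1 c.2).
Proof.
apply: rtree_forest_ind => [pre phi|t l IHt IHl pre phi|cs IH phi].
- by rewrite /= !big_mkcond !big_seq1.
- rewrite [vertsL _ _]/= big_mkcond big_subs_cat subs_map big_map.
  rewrite big_cutF_cons -(IHt (fun p r => \sum_(d <- cutF l) phi (p ++ d.1) (r ++ d.2))).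
  rewrite [RHS]big_mkcond big_seq [RHS]big_seq; apply: eq_bigr => C1 hC1.
  have headC2 C2 : C2 \in subs (vertsL (size pre).+1 l) ->
      forall a, a \in C2 -> (a != [::]) && (size pre < head 0 a)%N.
    by move=> hC2 a /(subs_mem hC2)/vertsL_head.
  transitivity (\sum_(C2 <- subs (vertsL (size pre).+1 l) | antichain C2)
     if antichain C1 then phi (map (subtree t) C1 ++ map (subtree (Node (pre ++ t :: l))) C2)
       ((if [::] \in C1 then [::] else [:: prune t C1]) ++ pruneL C2 (size pre).+1 l)
     else 0).
    rewrite big_seq [RHS]big_mkcond [RHS]big_seq; apply: eq_bigr => C2 /headC2 hC2.
    rewrite antichain_cat ?antichain_cons; last first.
      move=> a b /mapP[a' _ ->] /hC2; case: b => // x b /= hx.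
      by rewrite (ltn_eqF hx) (gtn_eqF hx).
    case: (antichain C2); rewrite ?andbT ?andbF //; case: (antichain C1) => //.
    rewrite pruneL_cons; last by move=> a /hC2 /andP[].
    rewrite map_cat -map_comp; congr (phi (_ ++ _) _).
    by apply: eq_map => a /=; rewrite nth_cat ltnn subnn.
  case: (antichain C1); last by rewrite big1.
  have := IHl (rcons pre t) (fun p r => phi ([seq subtree t i | i <- C1] ++ p)
            ((if [::] \in C1 then [::] else [:: prune t C1]) ++ r)).
  by rewrite size_rcons cat_rcons.
  rewrite verts_edges subs_cons big_cat big_map big_cutT_node edges_node.
  etransitivity; first exact: addrC.
  congr (_ + _).
    (* The root address is a prefix of every address, so an antichain containing it contains nothing
       else: this is the total cut. *)
    rewrite big_seq_cond (eq_bigl (fun C => (C \in subs (vertsL 0 cs)) && nilp C)).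
      rewrite -big_seq_cond (big_subs_nil _ (fun C =>
        phi (map (subtree (Node cs)) ([::] :: C))
            (if [::] \in [::] :: C then [::] else [:: prune (Node cs) ([::] :: C)]))).
      by rewrite in_cons eqxx.
    move=> C; case: (boolP (C \in _)) => //= hC; apply: antichain_nil.
    by apply/allP => a /(subs_mem hC)/vertsL_head/andP[].
  rewrite -(IH [::] (fun p r => phi p [:: Node r])) big_seq_cond [RHS]big_seq_cond.
  apply: eq_bigr => C /andP[hC _]; rewrite prune_node.
  by case: ifPn => // /(subs_mem hC)/vertsL_head.
Qed.

End CutSum.

Lemma mulF_mkF l m : mulF (mkF l) (mkF m) = mkF (l ++ m).
Proof. by apply: mkF_eq; apply: cforest_cat; rewrite val_mkF cforestK. Qed.

Lemma big_admissible (V : nmodType) cs (phi : seq rtree -> seq rtree -> V) :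
  \sum_(c <- cutF cs) phi c.1 [:: Node c.2] = phi [::] [:: Node cs] +
  \sum_(C <- subs (edges (Node cs)) | admissible_cut C)
    phi (map (subtree (Node cs)) C) [:: prune (Node cs) C].
Proof.
rewrite -((big_antichain _).2 cs [::] (fun p r => phi p [:: Node r])) -edges_node.
rewrite (bigID (@nilp _)); apply: (congr2 (@GRing.add V)); last first.
  by apply: eq_bigl => C; rewrite andbC /admissible_cut; case: C.
rewrite (eq_bigl (@nilp _)); last by case=> [|a C]; rewrite ?andbF.
rewrite (big_subs_nil _ (fun C => phi (map (subtree (Node ([::] ++ cs))) C)
  [:: Node (pruneL C (size (Nil rtree)) cs)])).
by rewrite prune_nil.2.
Qed.

(** The total cut gives t (x) 1 and the empty cut gives 1 (x) t. *)
Lemma DeltaT_cut t : DeltaT t = \sum_(c <- cutT t) << (mkF c.1, mkF c.2) >>.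
Proof.
case: t => cs; pose phi p r : H2 := << (mkF p, mkF r) >>.
rewrite (big_cutT_node cs phi) (big_admissible cs phi) /DeltaT /phi mkF_nil.
(* Generalized first: unification would unfold the basis vectors. *)
move: << _ >> << _ >> (\sum_(_ <- _ | _) _) => a b s.
by rewrite [b + a]addrC addrA.
Qed.

Lemma DeltaB_cut f : DeltaB f = \sum_(c <- cutF (val f)) << (mkF c.1, mkF c.2) >>.
Proof.
rewrite /DeltaB; elim: (val f) => [|t l IH] /=; first by rewrite big_seq1 /= mkF_nil.
rewrite {}IH DeltaT_cut (big_cutF_cons _ _ (fun p r => << (mkF p, mkF r) >>)).
rewrite /mul2 bilin_suml; apply: eq_bigr => c _.
rewrite -/(mul2 _ _) linear_sum; apply: eq_bigr => d _.
by rewrite /= /mul2 bilinU /= !mulF_mkF.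
Qed.

(** * Cuts and graftings of isomorphism classes *)

Definition cuts (f : forest) : seq (forest * forest) :=
  [seq (mkF c.1, mkF c.2) | c <- cutF (val f)].

Definition grafts (M N : forest) : seq forest :=
  [seq mkF g | g <- graftF (val M) (val N)].

Definition wF (f : forest) : nat := weightF (val f).

Lemma weight_canon : forall l, weightF (cforest l) = weightF l.
Proof.
have [_ h] : (forall t, wt (canon t) = wt t) /\
    (forall l, weightF (map canon l) = weightF l).
  apply: rtree_forest_ind => //= [t l et el|cs e].
    by rewrite /weightF /= et; congr (_ + _)%N.
  congr _.+1; rewrite -[RHS]e; apply: perm_sumn; apply: perm_map.
  by rewrite perm_sort.
move=> l; rewrite -[RHS]h; apply: perm_sumn; apply: perm_map.
exact: perm_cforest.
Qed.

Lemma wF_mkF l : wF (mkF l) = weightF l.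
Proof. by rewrite /wF val_mkF weight_canon. Qed.

Lemma weightF_cat l m : weightF (l ++ m) = (weightF l + weightF m)%N.
Proof. by rewrite /weightF map_cat sumn_cat. Qed.

Lemma weight_gt0 t : (0 < wt t)%N.
Proof. by case: t. Qed.

Lemma wF_eq0 f : (wF f == 0)%N = (f == F0).
Proof.
apply/idP/eqP => [|->]; last by [].
rewrite /wF => h; apply: val_inj; case E: (val f) h => [|t l] //.
by rewrite /weightF /= addn_eq0 -leqn0 leqNgt weight_gt0.
Qed.

Lemma weight_cut :
  (forall t c, c \in cutT t -> weightF c.1 + weightF c.2 = wt t)%N /\
  (forall l c, c \in cutF l -> weightF c.1 + weightF c.2 = weightF l)%N.
Proof.
apply: rtree_forest_ind => [c|t l IHt IHl c|cs IH c].
- by rewrite inE => /eqP ->.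
- case/allpairsP=> -[d e] [/IHt hd /IHl he ->] /=.
  by rewrite !weightF_cat addnACA hd he.
- rewrite cutT_node inE => /orP[/eqP ->|/mapP[d /IH hd ->]].
    by rewrite /weightF /= !addn0.
  by rewrite -[RHS]/((weightF cs).+1) -hd /weightF /= addn0 addnS.
Qed.

Lemma wF_cuts f c : c \in cuts f -> (wF c.1 + wF c.2 = wF f)%N.
Proof. by case/mapP=> d /weight_cut.2 hd -> /=; rewrite !wF_mkF. Qed.

Section ClassSums.
Variable V : nmodType.

Lemma big_cuts_mkF l (b : forest -> forest -> V) :
  \sum_(c <- cuts (mkF l)) b c.1 c.2 = \sum_(c <- cutF l) b (mkF c.1) (mkF c.2).
Proof.
rewrite /cuts big_map val_mkF (big_cut_class l (phi := fun p r => b (mkF p) (mkF r))) //.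
by move=> p r; congr b; apply: mkF_eq; rewrite cforestK.
Qed.

Lemma big_grafts_mkF l m (b : forest -> V) :
  \sum_(g <- grafts (mkF l) (mkF m)) b g = \sum_(g <- graftF l m) b (mkF g).
Proof.
have hb : class_fun (fun g => b (mkF g)).
  by move=> g; congr b; apply: mkF_eq; rewrite cforestK.
rewrite /grafts big_map !val_mkF (big_graft_classr _ _ hb).
by apply: (big_graft_classl V (cforestK l)).2.
Qed.

Lemma cuts_coassoc f (phi : forest -> forest -> forest -> V) :
  \sum_(c <- cuts f) \sum_(d <- cuts c.1) phi d.1 d.2 c.2 =
  \sum_(c <- cuts f) \sum_(d <- cuts c.2) phi c.1 d.1 d.2.
Proof.
rewrite ![in LHS]big_map [RHS]big_map.
under eq_bigr => c _ do rewrite (big_cuts_mkF c.1 (fun a b => phi a b _)).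
under [RHS]eq_bigr => c _ do rewrite (big_cuts_mkF c.2 (fun a b => phi _ a b)).
exact: (cut_coassoc V).2 _ (fun a b r => phi (mkF a) (mkF b) (mkF r)).
Qed.

Lemma mkF_eq0 l : (mkF l == F0) = nilp l.
Proof.
rewrite -wF_eq0 wF_mkF; case: l => // t l.
by rewrite /weightF /= addn_eq0 -leqn0 leqNgt weight_gt0.
Qed.

Lemma cuts_counitl f (b : forest -> forest -> V) :
  \sum_(c <- cuts f | c.1 == F0) b c.1 c.2 = b F0 f.
Proof.
rewrite big_map (eq_bigl (fun c => nilp c.1)); last by move=> c; apply: mkF_eq0.
rewrite ((cut_counitl V).2 _ (fun p r => b (mkF p) (mkF r))).
by rewrite mkF_nil mkF_val.
Qed.

Lemma cuts_counitr f (b : forest -> forest -> V) :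
  \sum_(c <- cuts f | c.2 == F0) b c.1 c.2 = b f F0.
Proof.
rewrite big_map (eq_bigl (fun c => nilp c.2)); last by move=> c; apply: mkF_eq0.
rewrite ((cut_counitr V).2 _ (fun p r => b (mkF p) (mkF r))).
by rewrite mkF_nil mkF_val.
Qed.

Lemma cuts_grafts M N (phi : forest -> forest -> V) :
  \sum_(g <- grafts M N) \sum_(c <- cuts g) phi c.1 c.2 =
  \sum_(d <- cuts N) \sum_(g <- grafts M d.1) phi g d.2 +
  \sum_(c <- cuts M) \sum_(d <- cuts N) \sum_(g <- grafts c.2 d.2) phi (mulF c.1 d.1) g.
Proof.
rewrite big_map; under eq_bigr => g _ do rewrite big_cuts_mkF.
rewrite ((cut_graft V).2 _ _ (fun p r => phi (mkF p) (mkF r))); last first.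
  by move=> p r; congr phi; apply: mkF_eq; rewrite cforestK.
rewrite big_map [in X in _ = _ + X]big_map; congr (_ + _).
  apply: eq_bigr => d _; rewrite -{2}(mkF_val M).
  by rewrite (big_grafts_mkF _ _ (fun g => phi g _)).
apply: eq_bigr => c _; rewrite big_map; apply: eq_bigr => d _.
by rewrite (big_grafts_mkF _ _ (fun g => phi _ g)) mulF_mkF.
Qed.

End ClassSums.

Lemma grafts_nil M : grafts M F0 = [::].
Proof. by []. Qed.

Lemma mulF_nilr f : mulF f F0 = f.
Proof. by rewrite /mulF cats0 mkF_val. Qed.

Lemma grafts_neq0 M N g : g \in grafts M N -> g != F0.
Proof.
rewrite /grafts; case/mapP=> h hh ->; rewrite mkF_eq0.
case: (val N) hh => // t l; rewrite /= mem_cat => /orP[] /mapP[x _ ->] //.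
Qed.

(** Each vertex contributes one copy of [N], which the factor 1/weight turns into 1 T N = N for
    nonempty [N]. *)
Lemma grafts1 N : grafts F0 N = nseq (wF N) N.
Proof.
have [_ h] : (forall t, graftT [::] t = nseq (wt t) t) /\
    (forall l, graftF [::] l = nseq (weightF l) l).
  apply: rtree_forest_ind => // [t l et el|cs e].
    by rewrite /= et el !map_nseq -nseqD.
  by rewrite graftT_node e map_nseq.
by rewrite /grafts h map_nseq mkF_val.
Qed.

(** * Grafting onto primitive elements *)

(* Naming the basis vectors fixes the path to the unit of [rat] inside them,
   which keeps conversion problems syntactic. *)
Definition vec (f : forest) : H := << f >>.
Definition vec2 (c : forest * forest) : H2 := << c >>.

Lemma extV (V : lmodType rat) (phi : forest -> V) f : ext phi (vec f) = phi f.
Proof. exact: extU. Qed.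

Lemma extV2 (V : lmodType rat) (phi : forest * forest -> V) c : ext phi (vec2 c) = phi c.
Proof. exact: extU. Qed.

Lemma ext_vec (x : H) : x = ext vec x.
Proof. exact: malg_ext. Qed.

Lemma ext_vec2 (x : H2) : x = ext vec2 x.
Proof. exact: malg_ext. Qed.

Lemma DeltaE x : Delta x = ext DeltaB x.
Proof. by []. Qed.

Lemma tensor2E x y : tensor2 x y = ext (fun f => ext (fun g => vec2 (f, g)) y) x.
Proof. exact: bilinE. Qed.

Lemma tensor2_extl (K : choiceType) (phi : K -> H) (x : {malg rat[K]}) y :
  tensor2 (ext phi x) y = ext (fun k => tensor2 (phi k) y) x.
Proof. exact: bilin_extl. Qed.

Lemma tensor2_extr (K : choiceType) (phi : K -> H) x (y : {malg rat[K]}) :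
  tensor2 x (ext phi y) = ext (fun k => tensor2 x (phi k)) y.
Proof. exact: bilin_extr. Qed.

Lemma tensor2U f g : tensor2 (vec f) (vec g) = vec2 (f, g).
Proof. exact: bilinU. Qed.

Lemma topE x y : top x y = ext (fun f => ext (topB f) y) x.
Proof. exact: bilinE. Qed.

Lemma top_extl (K : choiceType) (phi : K -> H) (x : {malg rat[K]}) y :
  top (ext phi x) y = ext (fun k => top (phi k) y) x.
Proof. exact: bilin_extl. Qed.

Lemma topDl x x' y : top (x + x') y = top x y + top x' y.
Proof. exact: bilinDl. Qed.

Lemma topZl a x y : top (a *: x) y = a *: top x y.
Proof. exact: bilinZl. Qed.

Lemma top_suml (I : Type) (r : seq I) (P : pred I) (F : I -> H) y :
  top (\sum_(i <- r | P i) F i) y = \sum_(i <- r | P i) top (F i) y.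
Proof. exact: bilin_suml. Qed.

Lemma tmapE Phi y : tmap Phi y = ext (fun c => tensor2 (Phi (vec c.1)) (Phi (vec c.2))) y.
Proof. by []. Qed.

Lemma OneE : One = vec F0.
Proof. by []. Qed.

Lemma DeltaB_cuts f : DeltaB f = \sum_(c <- cuts f) vec2 c.
Proof. by rewrite DeltaB_cut big_map. Qed.

Definition sweedler (V : lmodType rat) (b : forest -> forest -> V) (x : H) : V :=
  ext (fun f => \sum_(c <- cuts f) b c.1 c.2) x.

HB.instance Definition _ (V : lmodType rat) (b : forest -> forest -> V) :=
  GRing.isLinear.Build rat H V *:%R (sweedler b) (ext_is_linear _).

(** Grafting without the factor 1/weight, for which [cuts_grafts] holds as it stands. The factor is
    applied beforehand to the target by [wscale]. *)
Definition graft_sum (M N : forest) : H := \sum_(g <- grafts M N) vec g.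

Definition Hgraft (M : forest) (x : H) : H := ext (graft_sum M) x.

Definition wscale (s : nat -> rat) (x : H) : H := ext (fun N => s (wF N) *: vec N) x.

Section Sweedler.
Variable V : lmodType rat.
Implicit Types (b : forest -> forest -> V).

Lemma sweedlerE b x : sweedler b x = ext (fun c => b c.1 c.2) (Delta x).
Proof.
rewrite DeltaE ext_comp; apply: eq_ext => f.
by rewrite DeltaB_cuts ext_big; apply: eq_bigr => c _; rewrite extV2.
Qed.

Lemma sweedlerU b f : sweedler b (vec f) = \sum_(c <- cuts f) b c.1 c.2.
Proof. exact: extV. Qed.

Lemma ext_tensor2 (b : forest * forest -> V) x y :
  ext b (tensor2 x y) = ext (fun f => ext (fun g => b (f, g)) y) x.
Proof.
rewrite tensor2E ext_comp; apply: eq_ext => f.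
by rewrite ext_comp; apply: eq_ext => g; rewrite extV2.
Qed.

Lemma sweedler_primitive b p : primitive p ->
  sweedler b p = ext (b^~ F0) p + ext (b F0) p.
Proof.
move=> hp; rewrite sweedlerE hp extD; congr (_ + _); rewrite ext_tensor2 OneE.
  by apply: eq_ext => f; rewrite extV.
by rewrite extV.
Qed.

End Sweedler.

Lemma Delta_sweedler x : Delta x = sweedler (fun f g => vec2 (f, g)) x.
Proof. by rewrite sweedlerE {1}[Delta x]ext_vec2; apply: eq_ext => -[]. Qed.

Lemma tensor2_One_r x : tensor2 x One = ext (fun f => vec2 (f, F0)) x.
Proof. by rewrite OneE tensor2E; apply: eq_ext => f; rewrite extV. Qed.

Lemma tensor2_One_l x : tensor2 One x = ext (fun f => vec2 (F0, f)) x.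
Proof. by rewrite OneE tensor2E extV. Qed.

(* [Delta] is graded and so is the primitivity condition. *)
Lemma wscale_primitive s p : primitive p -> primitive (wscale s p).
Proof.
pose b (f g : forest) : H2 := s (wF f + wF g)%N *: vec2 (f, g).
move=> hp; rewrite /primitive.
have -> : Delta (wscale s p) = ext (fun c => b c.1 c.2) (Delta p).
  rewrite -sweedlerE DeltaE ext_comp; apply: eq_ext => f.
  rewrite extZ extV DeltaB_cuts scaler_sumr.
  by apply: eq_big_seq => -[c d] /wF_cuts /= e; rewrite /b /= e.
rewrite hp extD; congr (_ + _).
  rewrite !tensor2_One_r !ext_comp; apply: eq_ext => f.
  by rewrite extV2 extZ extV /b addn0.
rewrite !tensor2_One_l !ext_comp; apply: eq_ext => f.
by rewrite extV2 extZ extV /b add0n.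
Qed.

Lemma top_ext M x : top (vec M) x = Hgraft M (wscale (fun n => n%:R^-1) x).
Proof.
rewrite topE extV /Hgraft /wscale ext_comp; apply: eq_ext => N.
rewrite extZ extV /topB /graft_sum /grafts big_map; case: ifP => // /eqP.
by move=> ->; rewrite big_nil scaler0.
Qed.

(** In [cuts_grafts] a primitive target only has the cuts q (x) 1 and 1 (x) q. Grafting onto the
    empty forest gives 0, so the terms that graft onto the pruned part survive only for q (x) 1, and
    those that graft onto the trunk only for 1 (x) q. *)
Lemma Delta_Hgraft M q : primitive q ->
  Delta (Hgraft M q) = tensor2 (Hgraft M q) One +
    \sum_(c <- cuts M) tensor2 (vec c.1) (Hgraft c.2 q).
Proof.
move=> hq; rewrite Delta_sweedler.
pose b1 (f g : forest) : H2 := \sum_(h <- grafts M f) vec2 (h, g).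
pose b2 (c : forest * forest) (f g : forest) : H2 :=
  \sum_(h <- grafts c.2 g) vec2 (mulF c.1 f, h).
transitivity (sweedler b1 q + \sum_(c <- cuts M) sweedler (b2 c) q).
  rewrite /Hgraft /sweedler ext_comp -ext_sum -ext_add; apply: eq_ext => N.
  rewrite ext_big -(cuts_grafts M N (fun f g => vec2 (f, g))).
  by apply: eq_bigr => g _; rewrite extV.
congr (_ + _).
  rewrite sweedler_primitive // [X in _ + X](_ : _ = 0) ?addr0.
    rewrite tensor2_One_r /Hgraft ext_comp; apply: eq_ext => N.
    by rewrite ext_big; apply: eq_bigr => g _; rewrite extV.
  by rewrite -[RHS](ext_const0 _ q); apply: eq_ext => N; rewrite /b1 grafts_nil big_nil.
apply: eq_bigr => c _; rewrite sweedler_primitive // [X in X + _](_ : _ = 0) ?add0r.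
  rewrite /Hgraft tensor2_extr; apply: eq_ext => N; rewrite linear_sum.
  by apply: eq_bigr => g _; rewrite mulF_nilr; exact/esym/tensor2U.
by rewrite -[RHS](ext_const0 _ q); apply: eq_ext => N; rewrite /b2 grafts_nil big_nil.
Qed.

Lemma Delta_top x p : primitive p ->
  Delta (top x p) = tensor2 (top x p) One +
    sweedler (fun f g => tensor2 (vec f) (top (vec g) p)) x.
Proof.
move=> hp; rewrite {1 2}[x]ext_vec !top_extl tensor2_extl.
rewrite DeltaE ext_comp -ext_add; apply: eq_ext => M; rewrite -DeltaE.
pose q := wscale (fun n => n%:R^-1) p; have hq : primitive q by apply: wscale_primitive.
have E N : Hgraft N q = top (vec N) p by exact/esym/top_ext.
have E1 := congr1 (tensor2^~ One) (E M).
have E2 : \sum_(c <- cuts M) tensor2 (vec c.1) (Hgraft c.2 q) =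
    \sum_(c <- cuts M) tensor2 (vec c.1) (top (vec c.2) p).
  by apply: eq_bigr => c _; exact (congr1 (tensor2 (vec c.1)) (E c.2)).
exact: etrans (congr1 Delta (esym (E M)))
  (etrans (Delta_Hgraft M hq) (f_equal2 (fun a b : H2 => a + b) E1 E2)).
Qed.

(** * Sums over compositions *)

Lemma compsS m n : comps m.+1 n.+1 =
  [seq k :: c | k <- iota 1 n.+1, c <- comps m (n.+1 - k)].
Proof. by []. Qed.

(** The first argument of [comps] is fuel, and n has no composition with more than n parts. *)
Lemma comps_fuel m n : (n <= m)%N -> comps m n = comps n n.
Proof.
have [N] := ubnP n; elim: N m n => // N IH [|m] [|n] //; rewrite !ltnS => hn hm.
rewrite !compsS; congr flatten; apply/eq_in_map => k; rewrite mem_iota => /andP[k0 kn].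
have hk : (n.+1 - k <= n)%N by lia.
rewrite (IH m) 1?(IH n) //; lia.
Qed.

Lemma comps_sum m n a : a \in comps m n -> (sumn a == n) && all (fun k => 0 < k)%N a.
Proof.
elim: m n a => [|m IH] [|n] a //; try by rewrite mem_seq1 => /eqP ->.
rewrite compsS.
case/flatten_mapP=> k; rewrite mem_iota => /andP[k0 kn] /mapP[c /IH /andP[/eqP hs hc] ->] /=.
by rewrite hs hc k0 !andbT; apply/eqP; lia.
Qed.

Section Compositions.
Variables (H : zmodType) (top : H -> H -> H) (u : seq H -> H).
Hypothesis top_suml : forall (I : eqType) (r : seq I) (F : I -> H) y,
  top (\sum_(i <- r) F i) y = \sum_(i <- r) top (F i) y.

(** The starting value [x] is general because removing the first block changes it. For [x] the unit,
    1 T p = p gives back [topn]. *)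
Definition comp_sum (x : H) (ps : seq H) : H :=
  \sum_(a <- comps (size ps) (size ps)) foldl top x (map u (split_by a ps)).

Lemma comp_sum_nil x : comp_sum x [::] = x.
Proof. by rewrite /comp_sum big_seq1. Qed.

Lemma comp_sum_first x ps : (0 < size ps)%N ->
  comp_sum x ps = \sum_(1 <= k < (size ps).+1) comp_sum (top x (u (take k ps))) (drop k ps).
Proof.
move=> ps0; have [n hn] : exists n, size ps = n.+1 by exists (size ps).-1; rewrite prednK.
rewrite /comp_sum hn compsS big_allpairs_dep /index_iota subSS subn0 big_seq [RHS]big_seq.
apply: eq_bigr => k; rewrite mem_iota => /andP[k0 kn].
by rewrite size_drop hn comps_fuel //; lia.
Qed.

(** [comps] peels off the first block, whereas the recursion for [Phi] peels off the last. Induction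
    on the length and an exchange of sums reconcile the two; the one-block composition is treated
    apart. *)
Lemma comp_sum_last x ps : (0 < size ps)%N ->
  comp_sum x ps = \sum_(0 <= i < size ps) top (comp_sum x (take i ps)) (u (drop i ps)).
Proof.
have [N] := ubnP (size ps); elim: N x ps => // N IH x ps; rewrite ltnS => hN ps0.
rewrite comp_sum_first // big_nat_recr //= take_size drop_size comp_sum_nil.
rewrite [RHS]big_ltn // take0 drop0 comp_sum_nil addrC; congr (_ + _).
set n := size ps in hN ps0 *.
(* Here [k] is the end of the first block and [j] the start of the last one. *)
transitivity (\sum_(1 <= k < n) \sum_(1 <= j < n | (k <= j)%N)
    top (comp_sum (top x (u (take k ps))) (drop k (take j ps))) (u (drop j ps))).
  rewrite big_nat [RHS]big_nat; apply: eq_bigr => k /andP[k0 kn].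
  rewrite IH ?size_drop -/n; try lia.
  rewrite [RHS](big_cat_nat _ (n := k)) //=; last by lia.
  rewrite [X in _ = X + _](_ : _ = 0) ?add0r; last first.
    by rewrite big_nat_cond big_pred0 // => j; lia.
  rewrite [RHS](big_addn 0 n k) big_nat_cond [RHS]big_nat_cond.
  apply: eq_big => [j|j /andP[/andP[_ hj] _]]; first by lia.
  by rewrite drop_drop take_drop addnC.
rewrite (exchange_big_dep_nat xpredT) //= big_nat [RHS]big_nat.
apply: eq_bigr => j /andP[j0 jn].
have sj : size (take j ps) = j by rewrite size_take -/n jn.
rewrite [comp_sum x _]comp_sum_first sj // top_suml.
rewrite (big_cat_nat _ (n := j.+1)) //= [X in _ + X](_ : _ = 0) ?addr0; last first.
  by rewrite big_nat_cond big_pred0 // => k; lia.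
rewrite big_nat_cond [RHS]big_nat_cond; apply: eq_big => [k|k /andP[/andP[k0 kj] _]]; first by lia.
by rewrite take_takel // -ltnS.
Qed.

End Compositions.

Lemma zip_split (u : ufamily) a ps : (sumn a = size ps)%N ->
  [seq u r.1 r.2 | r <- zip a (split_by a ps)] =
  [seq u (size r) r | r <- split_by a ps].
Proof.
elim: a ps => //= k a IH ps hs; rewrite IH ?size_drop; last by lia.
by rewrite size_take; congr (u _ _ :: _); case: ltnP; lia.
Qed.

(** Each composition of n has exactly one number of parts, which lies between 1 and n, so the sum
    over k can be absorbed. *)
Lemma PhiRHS_comps (u : ufamily) ps : (0 < size ps)%N ->
  PhiRHS u ps = \sum_(a <- comps (size ps) (size ps))
    topn [seq u (size r) r | r <- split_by a ps].
Proof.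
move=> ps0; rewrite /PhiRHS (exchange_big_dep xpredT) //=.
rewrite big_seq [RHS]big_seq; apply: eq_bigr => a /comps_sum /andP[/eqP hs ha].
have [a0 an] : (0 < size a)%N /\ (size a <= size ps)%N.
  rewrite -hs; split; first by case: a hs ha ps0 => //= <-.
  by elim: a ha {hs} => //= k a IH /andP[k0 /IH]; lia.
rewrite zip_split // big_mkcond (bigD1_seq (size a)) /=; first last.
- exact: iota_uniq.
- by rewrite mem_index_iota ltnS a0 an.
by rewrite eqxx big1 ?addr0 // => k /negPf; rewrite eq_sym => ->.
Qed.

(** * Connected coalgebras with a grafting operation *)

Section WeightRecursion.
Variables (T : Type) (w : T -> nat) (V : Type) (v0 : V) (step : (T -> V) -> T -> V).

(** Recursion on [w] by iteration: when a round consults only smaller weights, the value at [f] is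
    stable after [w f + 1] rounds. *)
Definition wrec (f : T) : V := iter (w f).+1 step (fun=> v0) f.

Hypothesis step_local : forall g h f,
  (forall t, (w t < w f)%N -> g t = h t) -> step g f = step h f.

Lemma wrecE f : wrec f = step wrec f.
Proof.
have fuel n m t : (w t < n)%N -> (w t < m)%N ->
    iter n step (fun=> v0) t = iter m step (fun=> v0) t.
  elim: n m t => // n IH [//|m] t; rewrite !ltnS => hn hm /=.
  by apply: step_local => s hs; apply: IH; [apply: leq_trans hs hn | apply: leq_trans hs hm].
by apply: step_local => t ht; apply: fuel.
Qed.

End WeightRecursion.

(* [cuts f] lists the terms of the coproduct of the basis vector [e f], [o] is
   the index of the unit and [ext] is linear extension from the basis [e]. *)
Section ConnectedCoalgebra.
Variables (T : choiceType) (o : T) (cuts : T -> seq (T * T)) (w : T -> nat).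
Hypothesis w_cuts : forall f c, c \in cuts f -> (w c.1 + w c.2 = w f)%N.
Hypothesis w_eq0 : forall f, (w f == 0)%N = (f == o).
Hypothesis coassoc : forall (V : nmodType) f (phi : T -> T -> T -> V),
  \sum_(c <- cuts f) \sum_(d <- cuts c.1) phi d.1 d.2 c.2 =
  \sum_(c <- cuts f) \sum_(d <- cuts c.2) phi c.1 d.1 d.2.
Hypothesis counitl : forall (V : nmodType) f (b : T -> T -> V),
  \sum_(c <- cuts f | c.1 == o) b c.1 c.2 = b o f.
Hypothesis counitr : forall (V : nmodType) f (b : T -> T -> V),
  \sum_(c <- cuts f | c.2 == o) b c.1 c.2 = b f o.

Variables (H : lmodType rat) (e : T -> H).
Variable ext : forall V : lmodType rat, (T -> V) -> {linear H -> V}.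
Arguments ext {V}.
Hypothesis ext_e : forall (V : lmodType rat) (phi : T -> V) f, ext phi (e f) = phi f.
Hypothesis basis_eq : forall (V : lmodType rat) (g h : {linear H -> V}),
  (forall f, g (e f) = h (e f)) -> g =1 h.

Definition counit : {linear H -> rat^o} := ext (fun f => (f == o)%:R : rat^o).

(* Sweedler sums: [sw b x] is the value of [b] on the coproduct of [x], and
   [bext b] is the bilinear extension of [b]. *)
Definition sw (V : lmodType rat) (b : T -> T -> V) : {linear H -> V} :=
  ext (fun f => \sum_(c <- cuts f) b c.1 c.2).

Definition bext (V : lmodType rat) (b : T -> T -> V) (x y : H) : V :=
  ext (fun f => ext (b f) y) x.

(** The equation Delta p = p (x) 1 + 1 (x) p, tested against every bilinear [b]. *)
Definition prim (p : H) : Prop := forall (V : lmodType rat) (b : T -> T -> V),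
  sw b p = ext (b^~ o) p + ext (b o) p.

Variable top : H -> H -> H.
Hypothesis top_linl : forall y, linear (top^~ y).
Hypothesis top_linr : forall x, linear (top x).
Hypothesis top_unit : forall x, top (e o) x = x - counit x *: e o.
Hypothesis counit_top : forall x y, counit (top x y) = 0.
Hypothesis sw_top : forall (V : lmodType rat) (b : T -> T -> V) x p, prim p ->
  sw b (top x p) = ext (b^~ o) (top x p) +
    sw (fun f g => ext (b f) (top (e g) p)) x.

Definition topl (y x : H) : H := top x y.
Definition topr (x y : H) : H := top x y.
HB.instance Definition _ y := GRing.isLinear.Build rat H H *:%R (topl y) (top_linl y).
HB.instance Definition _ x := GRing.isLinear.Build rat H H *:%R (topr x) (top_linr x).

Lemma tDl x x' y : top (x + x') y = top x y + top x' y.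
Proof. exact: (linearD (topl y)). Qed.
Lemma tZl a x y : top (a *: x) y = a *: top x y.
Proof. by rewrite -[LHS]/(topl y _) linearZ. Qed.
Lemma t_suml I (r : seq I) (P : pred I) (F : I -> H) y :
  top (\sum_(i <- r | P i) F i) y = \sum_(i <- r | P i) top (F i) y.
Proof. exact: (linear_sum (topl y)). Qed.
Lemma t0r y : top y 0 = 0. Proof. exact: (linear0 (topr y)). Qed.
Lemma tZr a x y : top x (a *: y) = a *: top x y.
Proof. by rewrite -[LHS]/(topr x _) linearZ. Qed.

Lemma basis_lin (V : lmodType rat) (g h : H -> V) :
  linear g -> linear h -> (forall f, g (e f) = h (e f)) -> forall x, g x = h x.
Proof.
move=> hg hh E.
pose Gm := GRing.isLinear.Build rat H V *:%R g hg.
pose Hm := GRing.isLinear.Build rat H V *:%R h hh.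
pose G : {linear H -> V} := HB.pack g Gm.
pose K : {linear H -> V} := HB.pack h Hm.
exact: (basis_eq (g := G) (h := K)).
Qed.

Lemma lin_ext (V : lmodType rat) (g : H -> V) x : linear g -> g x = ext (fun f => g (e f)) x.
Proof. by move=> hg; apply: basis_lin => // [|f]; [exact: linearP | rewrite ext_e]. Qed.

Lemma eq_extA (V : lmodType rat) (phi psi : T -> V) : phi =1 psi -> ext phi =1 ext psi.
Proof. by move=> E; apply: basis_eq => f; rewrite !ext_e. Qed.

Lemma ext0 (V : lmodType rat) x : ext (fun=> 0 : V) x = 0.
Proof.
by apply: (basis_lin (h := fun=> 0)) => [|a y z|f];
  rewrite ?ext_e ?scaler0 ?addr0 //; exact: linearP.
Qed.

Lemma sw_e (V : lmodType rat) (b : T -> T -> V) f : sw b (e f) = \sum_(c <- cuts f) b c.1 c.2.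
Proof. exact: ext_e. Qed.

Lemma eq_sw (V : lmodType rat) (b b' : T -> T -> V) x :
  (forall f g, b f g = b' f g) -> sw b x = sw b' x.
Proof. by move=> E; apply: eq_extA => f; apply: eq_bigr => c _. Qed.

Lemma counit_e f : counit (e f) = (f == o)%:R.
Proof. exact: ext_e. Qed.

Lemma bext_lin (V : lmodType rat) (B : H -> H -> V) :
  (forall y, linear (B^~ y)) -> (forall x, linear (B x)) ->
  forall x y, bext (fun f g => B (e f) (e g)) x y = B x y.
Proof.
move=> Bl Br x y; rewrite [RHS](lin_ext (g := B^~ y)) //.
by apply: eq_extA => f; rewrite -(lin_ext (g := B (e f))).
Qed.

Lemma bext_is_linear (V : lmodType rat) (b : T -> T -> V) x : linear (bext b x).
Proof.
move=> a y z; rewrite /bext.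
apply: (@basis_lin _ _ (fun x => a *: ext (fun f => ext (b f) y) x +
  ext (fun f => ext (b f) z) x)) => [k u v|k u v|f].
- by rewrite linearP.
- by rewrite !linearP !scalerA [(k * a)%R]mulrC addrACA.
- by rewrite !ext_e linearP.
Qed.

HB.instance Definition _ (V : lmodType rat) (b : T -> T -> V) x :=
  GRing.isLinear.Build rat H V *:%R (bext b x) (bext_is_linear b x).

Lemma w_cuts1 f c : c \in cuts f -> c.1 != o -> (w c.2 < w f)%N.
Proof. by move=> /w_cuts <-; rewrite -w_eq0 -lt0n -{1}[w c.2]add0n ltn_add2r. Qed.

Lemma w_cuts2 f c : c \in cuts f -> c.2 != o -> (w c.1 < w f)%N.
Proof. by move=> /w_cuts <-; rewrite -w_eq0 -lt0n -{1}[w c.1]addn0 ltn_add2l. Qed.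

Lemma cuts_o c : c \in cuts o -> (c.1 == o) && (c.2 == o).
Proof.
move=> /w_cuts; have /eqP -> : w o == 0%N by rewrite w_eq0.
by move/eqP; rewrite addn_eq0 !w_eq0.
Qed.

Lemma big_cuts_o (V : nmodType) (b : T -> T -> V) : \sum_(c <- cuts o) b c.1 c.2 = b o o.
Proof.
rewrite -[RHS](counitl o b) [RHS]big_seq_cond big_seq; apply: eq_bigl => c.
by case: (boolP (c \in _)) => //= /cuts_o /andP[->].
Qed.

Lemma sw_counitr (V : lmodType rat) (phi : T -> V) x :
  sw (fun f g => (g == o)%:R *: phi f) x = ext phi x.
Proof.
apply: eq_extA => f; rewrite -[RHS](counitr f (fun a _ => phi a)) [RHS]big_mkcond.
by apply: eq_bigr => c _; case: eqP => _; rewrite ?scale1r ?scale0r.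
Qed.

Lemma prim_linear a p q : prim p -> prim q -> prim (a *: p + q).
Proof.
by move=> hp hq V b; rewrite !linearP hp hq scalerDr !addrA; congr (_ + _); rewrite addrAC.
Qed.

Lemma prim0 : prim 0.
Proof. by move=> V b; rewrite !linear0 addr0. Qed.

Lemma prim_add p q : prim p -> prim q -> prim (p + q).
Proof. by move=> hp hq; rewrite -[p]scale1r; apply: prim_linear. Qed.

Lemma prim_sum I (r : seq I) (P : pred I) (F : I -> H) :
  (forall i, P i -> prim (F i)) -> prim (\sum_(i <- r | P i) F i).
Proof. by move=> h; elim/big_ind: _; [apply: prim0 | apply: prim_add | ]. Qed.

(** Applying counit (x) counit to the primitivity equation gives counit p = 2 counit p. *)
Lemma counit_prim p : prim p -> counit p = 0.
Proof.
move=> /(_ _ (fun f g => (g == o)%:R *: ((f == o)%:R : rat^o))).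
rewrite sw_counitr -/counit (eq_extA (psi := fun f => (f == o)%:R : rat^o)) -/counit; last first.
  by move=> f /=; rewrite eqxx scale1r.
rewrite (eq_extA (psi := fun f => (f == o)%:R : rat^o)) -/counit; last first.
  by move=> f /=; rewrite eqxx /GRing.scale /= mulr1.
by move/eqP; rewrite -subr_eq subrr eq_sym => /eqP.
Qed.

(** ** The projection onto primitive elements *)

(** For f other than the unit, the term f' = 1 of f = sum f' T pi(f'') is pi(f) itself. It is
    isolated, and the other terms have f'' of smaller weight. *)
Definition proj0 : T -> H :=
  wrec w 0 (fun g f => if f == o then 0 else
    e f - \sum_(c <- cuts f | c.1 != o) top (e c.1) (g c.2)).

Lemma proj0E f : proj0 f = if f == o then 0 else
  e f - \sum_(c <- cuts f | c.1 != o) top (e c.1) (proj0 c.2).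
Proof.
apply: wrecE => g h t E; case: ifP => // _; congr (_ - _).
rewrite big_seq_cond [RHS]big_seq_cond; apply: eq_bigr => c /andP[hc hc1].
by rewrite E // (w_cuts1 hc).
Qed.

Definition proj : {linear H -> H} := ext proj0.

Lemma proj_e f : proj (e f) = proj0 f. Proof. exact: ext_e. Qed.

Lemma proj0_o : proj0 o = 0. Proof. by rewrite proj0E eqxx. Qed.

Lemma counit_proj0 f : counit (proj0 f) = 0.
Proof.
rewrite proj0E; case: ifPn => [_|nf]; first exact: linear0.
rewrite linearB counit_e (negPf nf) linear_sum big1 ?subr0 // => c _.
Qed.

Lemma top_proj0 f : top (e o) (proj0 f) = proj0 f.
Proof. by rewrite top_unit counit_proj0 scale0r subr0. Qed.

Lemma basis_decomp f :
  e f = (f == o)%:R *: e o + \sum_(c <- cuts f) top (e c.1) (proj0 c.2).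
Proof.
rewrite (bigID (fun c => c.1 == o)) /= (counitl f (fun a b => top (e a) (proj0 b))) top_proj0.
rewrite {1}proj0E; case: eqP => [->|_]; last by rewrite scale0r add0r subrK.
rewrite scale1r add0r big_seq_cond big_pred0 ?addr0 // => c.
by case: (boolP (c \in _)) => //= /cuts_o /andP[->].
Qed.

Lemma decomp x : x = counit x *: e o + sw (fun f g => top (e f) (proj0 g)) x.
Proof.
apply: (@basis_lin _ id (fun x => counit x *: e o +
  sw (fun f g => top (e f) (proj0 g)) x)) => [a y z //|a y z|f].
  by rewrite (linearP counit) (linearP (sw _)) scalerDl addrACA scalerDr scalerA.
by rewrite sw_e counit_e -basis_decomp.
Qed.

Lemma prim_proj0 f : prim (proj0 f).
Proof.
have [n] := ubnP (w f); elim: n f => // n IH f; rewrite ltnS => hf.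
have [->|nf] := eqVneq f o; first by rewrite proj0_o; apply: prim0.
move=> V b.
have E0 : proj0 f = e f - \sum_(c <- cuts f | c.1 != o) top (e c.1) (proj0 c.2).
  by rewrite {1}proj0E (negPf nf).
pose Y a b' c : V := ext (b a) (top (e b') (proj0 c)).
pose X := \sum_(c <- cuts f | c.1 != o) \sum_(d <- cuts c.1) Y d.1 d.2 c.2.
(* [sw_top] applies to each subtracted product, whose right factor is primitive by induction. *)
have E1 : sw b (proj0 f) = \sum_(c <- cuts f) b c.1 c.2 - (b f o - ext (b^~ o) (proj0 f) + X).
  rewrite {1}E0 linearB sw_e linear_sum; congr (_ - _).
  have -> : b f o = ext (b^~ o) (e f) by rewrite ext_e.
  rewrite -linearB E0 subKr linear_sum -big_split /=.
  rewrite big_seq_cond [RHS]big_seq_cond; apply: eq_bigr => c /andP[hc hc1].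
  rewrite sw_top ?sw_e //; apply: IH; apply: leq_trans hf; exact: w_cuts1 hc hc1.
(* The added summand is the missing term [c.1 = o]. It completes [X] to a full double sum, which
   coassociativity regroups; [basis_decomp] then evaluates the inner sum to [e c.2] minus its unit
   component. *)
have E2 : X + ext (b o) (proj0 f) = \sum_(c <- cuts f) b c.1 c.2 - b f o.
  transitivity (\sum_(c <- cuts f) \sum_(d <- cuts c.1) Y d.1 d.2 c.2).
    rewrite [RHS](bigID (fun c => c.1 == o)) /= addrC; congr (_ + _).
    rewrite (counitl f (fun a c => \sum_(d <- cuts a) Y d.1 d.2 c)).
    by rewrite (big_cuts_o (fun a b => Y a b f)) /Y top_proj0.
  rewrite coassoc; transitivity
      (\sum_(c <- cuts f) (b c.1 c.2 - (c.2 == o)%:R *: b c.1 o)).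
    apply: eq_bigr => c _; rewrite /Y -linear_sum.
    have -> : \sum_(d <- cuts c.2) top (e d.1) (proj0 d.2) = e c.2 - (c.2 == o)%:R *: e o.
      by rewrite [in RHS]basis_decomp addrC addKr.
    by rewrite linearB linearZ /= !ext_e.
  rewrite sumrB; congr (_ - _).
  by have := sw_counitr (b^~ o) (e f); rewrite sw_e ext_e.
rewrite E1; move/(canRL (addrK _)): E2 => ->.
rewrite opprD !opprB addrACA addKr.
by rewrite addrCA subrr addr0.
Qed.

Lemma prim_proj x : prim (proj x).
Proof.
move=> V b; apply: (@basis_lin _ (fun x => sw b (proj x))
  (fun x => ext (b^~ o) (proj x) + ext (b o) (proj x))) => [a y z|a y z|f].
- by rewrite !linearP.
- by rewrite !linearP scalerDr addrACA.
- by rewrite proj_e prim_proj0.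
Qed.

Lemma counit_proj x : counit (proj x) = 0.
Proof. exact: counit_prim (prim_proj x). Qed.

Lemma top_unit_prim p : prim p -> top (e o) p = p.
Proof. by move=> hp; rewrite top_unit counit_prim // scale0r subr0. Qed.

Lemma ext_top (V : lmodType rat) (phi : T -> V) x y :
  ext phi (top x y) = ext (fun f => ext phi (top (e f) y)) x.
Proof.
apply: (@basis_lin _ (fun x => ext phi (top x y))) => [a u v|a u v|f].
- by rewrite tDl tZl linearP.
- by rewrite linearP.
- by rewrite ext_e.
Qed.

Lemma proj_decomp x : counit x = 0 -> x = sw (fun f g => top (e f) (proj0 g)) x.
Proof. by move=> hx; rewrite {1}[x]decomp hx scale0r add0r. Qed.

Lemma top_ext_e (phi : T -> H) x y :
  ext (fun g => top x (phi g)) y = top x (ext phi y).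
Proof.
apply/esym/(@basis_lin _ (fun y => top x (ext phi y))) => [a u v|a u v|f].
- by rewrite linearP -[LHS]/(topr x _) linearP.
- by rewrite linearP.
- by rewrite !ext_e.
Qed.

(** For a basis vector x, decomposing y = x T p with [sw_top] gives y = sum x' T pi(x'' T p). The
    term x' = 1 is pi(y); by induction the others are eps(x'') x' T p, with sum y unless x = 1,
    where they are absent. Hence pi(y) = 0 for x other than 1, and pi(p) = p. *)
Lemma proj_top x p : prim p -> proj (top x p) = counit x *: p.
Proof.
move=> hp; apply: (@basis_lin _ (fun x => proj (top x p)) (fun x => counit x *: p)).
- by move=> a u v; rewrite tDl tZl linearP.
- by move=> a u v; rewrite linearP scalerDl scalerA.
move=> {}x; have [n] := ubnP (w x); elim: n x => // n IH x; rewrite ltnS => hx.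
rewrite counit_e; set y := top (e x) p.
have E : y = \sum_(c <- cuts x) top (e c.1) (proj (top (e c.2) p)).
  rewrite {1}[y]proj_decomp ?counit_top // sw_top //.
  rewrite (eq_extA (psi := fun=> 0)) ?ext0 ?add0r => [|f]; last by rewrite proj0_o t0r.
  by rewrite sw_e; apply: eq_bigr => c _; rewrite top_ext_e.
have E1 : \sum_(c <- cuts x | c.1 == o) top (e c.1) (proj (top (e c.2) p)) = proj y.
  rewrite (counitl x (fun a b => top (e a) (proj (top (e b) p)))).
  by rewrite top_unit counit_proj scale0r subr0.
have E2 : \sum_(c <- cuts x | c.1 != o) top (e c.1) (proj (top (e c.2) p)) =
    (x != o)%:R *: y.
  transitivity (\sum_(c <- cuts x | c.2 == o) (c.1 != o)%:R *: top (e c.1) p).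
    rewrite big_mkcond [RHS]big_mkcond big_seq [RHS]big_seq; apply: eq_bigr => c hc.
    case: ifPn => [hc1|_]; last by case: ifP; rewrite ?scale0r.
    rewrite IH; last by apply: leq_trans hx; apply: w_cuts1 hc hc1.
    by rewrite counit_e tZr; case: eqP; rewrite ?scale1r ?scale0r.
  by rewrite (counitr x (fun a _ => (a != o)%:R *: top (e a) p)).
have : y = proj y + (x != o)%:R *: y.
  by rewrite {1}E (bigID (fun c => c.1 == o)) /= E1 E2.
case: eqVneq => [xo|_] /=; rewrite ?scale0r ?scale1r ?addr0.
  by move=> <-; rewrite /y xo top_unit_prim.
by move/eqP; rewrite -subr_eq subrr => /eqP <-.
Qed.

(** ** Coalgebra endomorphisms from primitive-valued maps *)

Section FromPrimitiveMap.
Variable U : {linear H -> H}.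
Hypothesis primU : forall x, prim (U x).
Hypothesis U_unit : U (e o) = 0.

(** Excluding [c.2 = o] makes the recursion well founded; U(1) = 0 lets [endo0E] restore the full
    sum. *)
Definition endo0 : T -> H :=
  wrec w 0 (fun g f => (f == o)%:R *: e o +
    \sum_(c <- cuts f | c.2 != o) top (g c.1) (U (e c.2))).

Lemma endo0E f : endo0 f =
  (f == o)%:R *: e o + \sum_(c <- cuts f) top (endo0 c.1) (U (e c.2)).
Proof.
rewrite /endo0 wrecE; last first.
  move=> g h t E; congr (_ + _); rewrite big_seq_cond [RHS]big_seq_cond.
  by apply: eq_bigr => c /andP[hc hc2]; rewrite E // (w_cuts2 hc).
congr (_ + _); rewrite big_mkcond; apply: eq_bigr => c _.
by case: eqP => // ->; rewrite U_unit t0r.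
Qed.

Definition endo : {linear H -> H} := ext endo0.

Lemma endo_e f : endo (e f) = endo0 f. Proof. exact: ext_e. Qed.

Lemma endo_unit : endo (e o) = e o.
Proof.
rewrite endo_e endo0E eqxx scale1r (big_cuts_o (fun a b => top (endo0 a) (U (e b)))).
by rewrite U_unit t0r addr0.
Qed.

Lemma endo_unique (Psi : {linear H -> H}) :
  (forall f, Psi (e f) =
    (f == o)%:R *: e o + \sum_(c <- cuts f) top (Psi (e c.1)) (U (e c.2))) ->
  Psi =1 endo.
Proof.
move=> hPsi; apply: basis_eq => f; rewrite endo_e.
have [n] := ubnP (w f); elim: n f => // n IH f; rewrite ltnS => hf.
rewrite hPsi endo0E; congr (_ + _); rewrite big_seq [RHS]big_seq.
apply: eq_bigr => c hc; have [->|nc] := eqVneq c.2 o; first by rewrite U_unit !t0r.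
by rewrite IH //; apply: leq_trans hf; apply: w_cuts2 hc nc.
Qed.

Lemma counit_endo x : counit (endo x) = counit x.
Proof.
apply: (@basis_lin _ (fun x => counit (endo x))) => [a u v|a u v|f].
- by rewrite !linearP.
- by rewrite linearP.
rewrite endo_e endo0E linearD linearZ /= !counit_e eqxx linear_sum big1 ?addr0.
  by rewrite /GRing.scale /= mulr1.
by move=> c _; apply: counit_top.
Qed.

(** Induction on the weight: [sw_top], the hypothesis at [c.1], coassociativity, and the recursion
    once more at [c.2]. The inner sum lacks the unit term of that recursion; the defect cancels
    against Phi(x) (x) 1. *)
Lemma sw_endo (V : lmodType rat) (b : T -> T -> V) x :
  sw b (endo x) = sw (fun f g => bext b (endo (e f)) (endo (e g))) x.
Proof.
apply: (@basis_lin _ (fun x => sw b (endo x))) => [a u v|a u v|f].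
- by rewrite !linearP.
- by rewrite linearP.
rewrite sw_e endo_e.
have [n] := ubnP (w f); elim: n f V b => // n IH f V b; rewrite ltnS => hf.
have E0 g : \sum_(c <- cuts g) top (endo0 c.1) (U (e c.2)) = endo0 g - (g == o)%:R *: e o.
  by rewrite [in RHS]endo0E addrC addKr.
pose Y a b' c : V := ext (fun f' => ext (b f') (top (endo0 b') (U (e c)))) (endo0 a).
transitivity (ext (b^~ o) (endo0 f) + \sum_(c <- cuts f) \sum_(d <- cuts c.1) Y d.1 d.2 c.2).
  rewrite {1}endo0E linearD linearZ /= sw_e (big_cuts_o b) linear_sum.
  have -> : ext (b^~ o) (endo0 f) = (f == o)%:R *: b o o +
      \sum_(c <- cuts f) ext (b^~ o) (top (endo0 c.1) (U (e c.2))).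
    by rewrite {1}endo0E linearD linearZ /= ext_e linear_sum.
  rewrite -addrA -big_split /=; congr (_ + _).
  rewrite big_seq [RHS]big_seq; apply: eq_bigr => c hc.
  rewrite sw_top //; congr (_ + _).
  have [c2|nc] := eqVneq c.2 o.
    rewrite c2 U_unit (eq_sw (b' := fun _ _ => 0)); last by move=> *; rewrite t0r linear0.
    rewrite (eq_extA (psi := fun=> 0)) ?ext0; last by move=> *; rewrite big1.
    rewrite big1 // => d _; rewrite /Y U_unit (eq_extA (psi := fun=> 0)) ?ext0 //.
    by move=> *; rewrite t0r linear0.
  rewrite (IH c.1 V (fun f' g' => ext (b f') (top (e g') (U (e c.2))))); last first.
    by apply: leq_trans hf; apply: w_cuts2 hc nc.
  apply: eq_bigr => d _; rewrite /Y /bext !endo_e; apply: eq_extA => f'.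
  by rewrite -ext_top.
rewrite coassoc; transitivity (ext (b^~ o) (endo0 f) +
    \sum_(c <- cuts f) (bext b (endo0 c.1) (endo0 c.2) - (c.2 == o)%:R *: ext (b^~ o) (endo0 c.1))).
  congr (_ + _); apply: eq_bigr => c _.
  transitivity (bext b (endo0 c.1) (\sum_(d <- cuts c.2) top (endo0 d.1) (U (e d.2)))).
    by rewrite linear_sum.
  rewrite E0 linearB linearZ /=; congr (_ - _ *: _).
  by apply: eq_extA => f'; rewrite ext_e.
rewrite sumrB addrC.
have := sw_counitr (fun a => ext (b^~ o) (endo0 a)) (e f); rewrite sw_e ext_e => ->.
rewrite subrK; by apply: eq_bigr => c _; rewrite !endo_e.
Qed.

End FromPrimitiveMap.

Lemma coalgebra_endo_decomp (Phi : {linear H -> H}) :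
  (forall (V : lmodType rat) (b : T -> T -> V) x,
     sw b (Phi x) = sw (fun f g => bext b (Phi (e f)) (Phi (e g))) x) ->
  (forall x, counit (Phi x) = counit x) ->
  forall f, Phi (e f) =
    (f == o)%:R *: e o + \sum_(c <- cuts f) top (Phi (e c.1)) (proj (Phi (e c.2))).
Proof.
move=> hsw hcounit f; rewrite {1}[Phi _]decomp hcounit counit_e hsw sw_e; congr (_ + _).
apply: eq_bigr => c _; rewrite /bext (eq_extA (psi := fun f' =>
  top (e f') (proj (Phi (e c.2))))); last by move=> f'; rewrite top_ext_e.
by rewrite -(lin_ext (g := top^~ _)).
Qed.

Definition prims_seq (ps : seq H) : Prop := forall q, q \in ps -> prim q.

Lemma prims_cons p ps : prims_seq (p :: ps) <-> prim p /\ prims_seq ps.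
Proof.
split=> [h|[hp h] q].
  by split=> [|q hq]; apply: h; rewrite inE ?eqxx // hq orbT.
by rewrite inE => /orP[/eqP -> //|/h].
Qed.

Lemma prims_cat ps qs : prims_seq (ps ++ qs) <-> prims_seq ps /\ prims_seq qs.
Proof.
split=> [h|[hp hq] q]; last by rewrite mem_cat => /orP[/hp|/hq].
by split=> q hq; apply: h; rewrite mem_cat hq ?orbT.
Qed.

Lemma prims_rcons p ps : prims_seq (rcons ps p) <-> prims_seq ps /\ prim p.
Proof.
rewrite -cats1 prims_cat; split=> -[h1 h2]; split=> //.
  by apply: h2; rewrite inE.
by move=> q; rewrite inE => /eqP ->.
Qed.

Lemma prims_take n ps : prims_seq ps -> prims_seq (take n ps).
Proof. by move=> h q /mem_take /h. Qed.

Lemma prims_drop n ps : prims_seq ps -> prims_seq (drop n ps).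
Proof. by move=> h q /mem_drop /h. Qed.

Lemma foldl_top_linear ps : linear (fun x => foldl top x ps).
Proof. by move=> a; elim: ps => //= p ps IH x y; rewrite -IH tDl tZl. Qed.

(** ** Linear maps with prescribed values on iterated products *)

Section Lift.
Variable u : seq H -> H.
Hypothesis u_prim : forall ps, prims_seq ps -> prim (u ps).
Hypothesis u_linear : forall l1 l2 a x y,
  prims_seq l1 -> prims_seq l2 -> prim x -> prim y ->
  u (l1 ++ (a *: x + y) :: l2) = a *: u (l1 ++ x :: l2) + u (l1 ++ y :: l2).

(* Taking the list of factors already split off as a second argument gives
   [lift qs (p_n T ... T p_1) = u (p_n :: ... :: p_1 :: qs)]. *)
Definition lift0 : T * seq H -> H :=
  wrec (fun z => w z.1) 0 (fun g z => (z.1 == o)%:R *: u z.2 +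
    \sum_(c <- cuts z.1 | c.2 != o) g (c.1, proj0 c.2 :: z.2)).

Lemma lift0E_cond f qs : lift0 (f, qs) =
  (f == o)%:R *: u qs + \sum_(c <- cuts f | c.2 != o) lift0 (c.1, proj0 c.2 :: qs).
Proof.
rewrite /lift0 wrecE // => g h [t l] /= E; congr (_ + _).
rewrite big_seq_cond [RHS]big_seq_cond; apply: eq_bigr => c /andP[hc hc2].
by rewrite E //= (w_cuts2 hc).
Qed.

Lemma lift0_prim f qs : prims_seq qs -> prim (lift0 (f, qs)).
Proof.
have [n] := ubnP (w f); elim: n f qs => // n IH f qs; rewrite ltnS => hf hqs.
rewrite lift0E_cond; apply: prim_linear; first exact: u_prim.
rewrite big_seq_cond; apply: prim_sum => c /andP[hc hc2]; apply: IH.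
  by apply: leq_trans hf; apply: w_cuts2 hc hc2.
by apply/prims_cons; split=> //; apply: prim_proj0.
Qed.

Lemma lift0_linear f l1 l2 a x y :
  prims_seq l1 -> prims_seq l2 -> prim x -> prim y ->
  lift0 (f, l1 ++ (a *: x + y) :: l2) =
  a *: lift0 (f, l1 ++ x :: l2) + lift0 (f, l1 ++ y :: l2).
Proof.
have [n] := ubnP (w f); elim: n f l1 => // n IH f l1; rewrite ltnS => hf h1 h2 hx hy.
rewrite !lift0E_cond u_linear // !scalerDr !scalerA addrACA [a * _]mulrC; congr (_ + _).
rewrite scaler_sumr -big_split /= big_seq_cond [RHS]big_seq_cond.
apply: eq_bigr => c /andP[hc hc2]; rewrite -!cat_cons IH //.
  by apply: leq_trans hf; apply: w_cuts2 hc hc2.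
by apply/prims_cons; split=> //; apply: prim_proj0.
Qed.

Lemma lift0_0 f qs : prims_seq qs -> lift0 (f, 0 :: qs) = 0.
Proof.
move=> hqs; have hnil : prims_seq [::] by [].
have h := @lift0_linear f [::] qs 1 0 0 hnil hqs prim0 prim0.
rewrite scaler0 addr0 scale1r /= in h.
by move/eqP: h; rewrite -subr_eq subrr eq_sym => /eqP.
Qed.

Lemma lift0E f qs : prims_seq qs -> lift0 (f, qs) =
  (f == o)%:R *: u qs + \sum_(c <- cuts f) lift0 (c.1, proj0 c.2 :: qs).
Proof.
move=> hqs; rewrite lift0E_cond; congr (_ + _); rewrite big_mkcond.
apply: eq_bigr => c _; case: eqP => // ->.
by rewrite proj0_o lift0_0.
Qed.

Definition lift (qs : seq H) : {linear H -> H} := ext (fun f => lift0 (f, qs)).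

Lemma liftE x qs : prims_seq qs -> lift qs x =
  counit x *: u qs + sw (fun f g => lift0 (f, proj0 g :: qs)) x.
Proof.
move=> hqs; apply: (@basis_lin _ (lift qs)
  (fun x => counit x *: u qs + sw (fun f g => lift0 (f, proj0 g :: qs)) x)).
- exact: linearP.
- move=> a y z.
  by rewrite (linearP counit) (linearP (sw _)) scalerDl addrACA scalerDr scalerA.
- by move=> f; rewrite ext_e counit_e sw_e lift0E.
Qed.

(** The parts split off x T p are pi(x'' T p) = eps(x'') p, so exactly the factor p is removed. *)
Lemma lift_top x p qs : prim p -> prims_seq qs -> lift qs (top x p) = lift (p :: qs) x.
Proof.
move=> hp hqs; rewrite liftE // counit_top scale0r add0r sw_top //.
rewrite (eq_extA (psi := fun=> 0)) ?ext0 ?add0r; last first.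
  by move=> f; rewrite proj0_o lift0_0.
apply: eq_extA => f; rewrite -(counitr f (fun a _ => lift0 (a, p :: qs))) [RHS]big_mkcond.
apply: eq_bigr => c _.
transitivity (lift0 (c.1, proj (top (e c.2) p) :: qs)).
  rewrite [RHS](lin_ext (g := fun z => lift0 (c.1, proj z :: qs))).
    by apply: eq_extA => g; rewrite proj_e.
  move=> a y z; rewrite linearP -[_ :: qs]cat0s lift0_linear //; exact: prim_proj.
rewrite proj_top // counit_e; case: eqP => _; first by rewrite scale1r.
by rewrite scale0r lift0_0.
Qed.

Lemma lift_foldl x ps qs : prims_seq ps -> prims_seq qs ->
  lift qs (foldl top x ps) = lift (ps ++ qs) x.
Proof.
elim/last_ind: ps qs => [//|ps p IH] qs /prims_rcons [hps hp] hqs.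
rewrite foldl_rcons lift_top // IH // ?cat_rcons //.
by apply/prims_cons.
Qed.

Lemma lift_values ps : prims_seq ps -> lift [::] (foldl top (e o) ps) = u ps.
Proof.
move=> hps; rewrite lift_foldl // cats0 ext_e lift0E_cond eqxx scale1r.
rewrite big_seq_cond big_pred0 ?addr0 // => c.
by case: (boolP (c \in _)) => //= /cuts_o /andP[_ ->].
Qed.

Lemma lift_prim x : prim (lift [::] x).
Proof.
move=> V b; apply: (@basis_lin _ (fun x => sw b (lift [::] x))
  (fun x => ext (b^~ o) (lift [::] x) + ext (b o) (lift [::] x))) => [a y z|a y z|f].
- by rewrite !linearP.
- by rewrite !linearP scalerDr addrACA.
- by rewrite ext_e; apply: lift0_prim.
Qed.

End Lift.

(** ** Iterated products of primitive elements *)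

(** Spanning by the iterated products, in the form in which it is applied to linear maps. *)
Lemma iterated_span (V : lmodType rat) (g h : {linear H -> V}) :
  (forall ps, prims_seq ps -> g (foldl top (e o) ps) = h (foldl top (e o) ps)) ->
  g =1 h.
Proof.
move=> E; apply: basis_eq => f.
(* Trailing factors are carried along because decomposing [e f] puts the primitive [proj0 c.2] in
   front of them. *)
suff gen : forall qs, prims_seq qs -> g (foldl top (e f) qs) = h (foldl top (e f) qs).
  exact: (gen [::]).
have [n] := ubnP (w f); elim: n f => // n IH f; rewrite ltnS => hf qs hqs.
pose L := GRing.isLinear.Build rat H H *:%R _ (foldl_top_linear qs).
pose F : {linear H -> H} := HB.pack (fun x => foldl top x qs) L.
rewrite -[foldl top (e f) qs]/(F (e f)) basis_decomp !linearD !linearZ !linear_sum /=.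
rewrite E //; congr (_ + _); rewrite big_seq [RHS]big_seq; apply: eq_bigr => c hc.
have [->|nc] := eqVneq c.2 o.
  by rewrite proj0_o t0r -[foldl top 0 qs]/(F 0) !linear0.
apply: (IH c.1 _ (proj0 c.2 :: qs)); first by apply: leq_trans hf; apply: w_cuts2 hc nc.
by apply/prims_cons; split=> //; apply: prim_proj0.
Qed.

Lemma bext_top (V : lmodType rat) (b : T -> T -> V) x y p :
  bext (fun f g => ext (b f) (top (e g) p)) x y = bext b x (top y p).
Proof. by apply: eq_extA => f; rewrite [RHS]ext_top. Qed.

(** Deconcatenation, by induction on the last factor p: it joins the right part, except in the term
    (x T p) (x) 1. *)
Lemma sw_foldl (V : lmodType rat) (b : T -> T -> V) ps : prims_seq ps ->
  sw b (foldl top (e o) ps) = \sum_(0 <= i < (size ps).+1)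
    bext b (foldl top (e o) (take i ps)) (foldl top (e o) (drop i ps)).
Proof.
elim/last_ind: ps V b => [|ps p IH] V b.
  by move=> _; rewrite big_nat1 /= sw_e (big_cuts_o b) /bext !ext_e.
move=> /prims_rcons [hps hp]; rewrite foldl_rcons sw_top // IH //.
rewrite size_rcons [RHS]big_nat_recr //= [RHS]addrC; congr (_ + _); last first.
  rewrite !big_nat; apply: eq_bigr => i /andP[_ hi]; rewrite bext_top.
  rewrite drop_rcons // foldl_rcons; congr bext.
  by rewrite -cats1 takel_cat.
rewrite take_oversize ?size_rcons // drop_oversize ?size_rcons //= foldl_rcons.
by rewrite /bext; apply: eq_extA => f; rewrite ext_e.
Qed.

(** The recursion evaluated on the deconcatenated coproduct; the position [i = size ps] drops out
    because U(1) = 0. *)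
Lemma endo_foldl (U : {linear H -> H}) ps : U (e o) = 0 -> prims_seq ps ->
  (0 < size ps)%N ->
  endo U (foldl top (e o) ps) = \sum_(0 <= i < size ps)
    top (endo U (foldl top (e o) (take i ps))) (U (foldl top (e o) (drop i ps))).
Proof.
move=> U0 hps ps0.
transitivity (sw (fun f g => top (endo U (e f)) (U (e g))) (foldl top (e o) ps)).
  have c0 : counit (foldl top (e o) ps) = 0.
    by case/lastP: ps ps0 {hps} => // l p _; rewrite foldl_rcons counit_top.
  transitivity (counit (foldl top (e o) ps) *: e o +
    sw (fun f g => top (endo U (e f)) (U (e g))) (foldl top (e o) ps)); last first.
    by rewrite c0 scale0r add0r.
  apply: (@basis_lin _ (endo U) (fun x => counit x *: e o +
    sw (fun f g => top (endo U (e f)) (U (e g))) x)).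
  - exact: linearP.
  - move=> a y z.
    by rewrite (linearP counit) (linearP (sw _)) scalerDl addrACA scalerDr scalerA.
  - move=> f; rewrite counit_e sw_e endo_e endo0E //.
    by under [in RHS]eq_bigr => c _ do rewrite endo_e.
rewrite sw_foldl // big_nat_recr //= drop_size.
have B x y : bext (fun f g => top (endo U (e f)) (U (e g))) x y = top (endo U x) (U y).
  apply: (bext_lin (B := fun x y => top (endo U x) (U y))) => [z a s t|z a s t].
    by rewrite linearP tDl tZl.
  by rewrite linearP -[LHS]/(topr _ _) linearP.
by rewrite B /= U0 t0r addr0; apply: eq_bigr => i _; rewrite B.
Qed.

Definition is_coalgebra_endo (Phi : H -> H) : Prop :=
  (forall (V : lmodType rat) (b : T -> T -> V) x,
     sw b (Phi x) = sw (fun f g => bext b (Phi (e f)) (Phi (e g))) x) /\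
  (forall x, counit (Phi x) = counit x).

Lemma comp_sum_rec (Phi : H -> H) (u : seq H -> H) ps : Phi (e o) = e o ->
  (forall qs, prims_seq qs -> (0 < size qs)%N -> Phi (foldl top (e o) qs) =
    \sum_(0 <= i < size qs) top (Phi (foldl top (e o) (take i qs))) (u (drop i qs))) ->
  prims_seq ps -> Phi (foldl top (e o) ps) = comp_sum top u (e o) ps.
Proof.
move=> Phi1 hPhi; have [n] := ubnP (size ps); elim: n ps => // n IH ps; rewrite ltnS => hn hps.
case: (posnP (size ps)) => [/size0nil -> /=|ps0]; first by rewrite comp_sum_nil.
rewrite hPhi // comp_sum_last //; last by move=> *; apply: t_suml.
rewrite big_nat [RHS]big_nat; apply: eq_bigr => i /andP[_ hi].
by rewrite IH //; [rewrite size_take hi; apply: leq_trans hn | apply: prims_take].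
Qed.

Theorem endo_of_family (u : seq H -> H) :
  (forall ps, (0 < size ps)%N -> prims_seq ps -> prim (u ps)) ->
  (forall l1 l2 a x y, prims_seq l1 -> prims_seq l2 -> prim x -> prim y ->
    u (l1 ++ (a *: x + y) :: l2) = a *: u (l1 ++ x :: l2) + u (l1 ++ y :: l2)) ->
  exists Phi : {linear H -> H}, [/\ Phi (e o) = e o, is_coalgebra_endo Phi
    & forall ps, prims_seq ps -> Phi (foldl top (e o) ps) = comp_sum top u (e o) ps].
Proof.
(* The value at the empty list is reset to 0, which ensures U(1) = 0. *)
move=> u_prim u_lin; pose u0 qs := if nilp qs then 0 else u qs.
have u0_prim ps : prims_seq ps -> prim (u0 ps).
  by rewrite /u0 /nilp; case: posnP => [_ _|]; [apply: prim0 | apply: u_prim].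
have u0_lin l1 l2 a x y : prims_seq l1 -> prims_seq l2 -> prim x -> prim y ->
    u0 (l1 ++ (a *: x + y) :: l2) = a *: u0 (l1 ++ x :: l2) + u0 (l1 ++ y :: l2).
  by move=> *; rewrite /u0 !cat_nilp !andbF u_lin.
pose U := lift u0 [::].
have hU x : prim (U x) by apply: lift_prim.
have U1 : U (e o) = 0 by rewrite /U (lift_values u0_lin (ps := [::])).
exists (endo U); split; first exact: endo_unit.
  by split=> [V b x|x]; [apply: sw_endo | apply: counit_endo].
move=> ps; apply: comp_sum_rec => [|qs hqs qs0]; first exact: endo_unit.
rewrite endo_foldl // big_nat [RHS]big_nat; apply: eq_bigr => i /andP[_ hi].
rewrite /U (lift_values u0_lin); last exact: prims_drop.
by rewrite /u0 /nilp size_drop subn_eq0 leqNgt hi.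
Qed.

Theorem family_of_endo (Phi : {linear H -> H}) :
  Phi (e o) = e o -> is_coalgebra_endo Phi ->
  forall ps, prims_seq ps -> Phi (foldl top (e o) ps) =
    comp_sum top (fun qs => proj (Phi (foldl top (e o) qs))) (e o) ps.
Proof.
move=> Phi1 [hsw hcounit] ps.
pose U : {linear H -> H} := proj \o Phi.
have U1 : U (e o) = 0 by rewrite /= Phi1 proj_e proj0_o.
have E : Phi =1 endo U.
  by apply: endo_unique => // f; exact: coalgebra_endo_decomp.
by apply: comp_sum_rec => // qs hqs qs0; rewrite E endo_foldl //; apply: eq_bigr => i _; rewrite -E.
Qed.

(** This gives uniqueness of the family. Sorted by last block, the summands are x T u(...), which
    [proj_top] sends to counit(x) u(...); only [i = 0], where x = 1, has nonzero counit. *)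
Theorem proj_comp_sum (u : seq H -> H) ps :
  (forall qs, (0 < size qs)%N -> prims_seq qs -> prim (u qs)) ->
  (0 < size ps)%N -> prims_seq ps -> proj (comp_sum top u (e o) ps) = u ps.
Proof.
move=> u_prim ps0 hps; have tsum : forall (I : eqType) (r : seq I) (F : I -> H) y,
  top (\sum_(i <- r) F i) y = \sum_(i <- r) top (F i) y by move=> *; apply: t_suml.
rewrite comp_sum_last // linear_sum.
rewrite (eq_big_nat _ _ (F2 := fun i => (i == 0%N)%:R *: u (drop i ps))); last first.
  move=> i /andP[_ hi]; rewrite proj_top; last first.
    by apply: u_prim; [rewrite size_drop subn_gt0 | apply: prims_drop].
  case: i hi => [|i] hi; first by rewrite take0 comp_sum_nil counit_e eqxx.
  have ti : (0 < size (take i.+1 ps))%N by rewrite size_take hi.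
  rewrite comp_sum_last // linear_sum big1 ?scale0r //.
rewrite big_ltn // scale1r drop0 big_nat_cond big1 ?addr0 // => i.
by case: i => // i _; rewrite scale0r.
Qed.

End ConnectedCoalgebra.

(** * Application to rooted trees *)

Definition HL : lmodType rat := {malg rat[forest]}.

Definition extL (V : lmodType rat) (phi : forest -> V) : {linear HL -> V} := ext phi.

Lemma extL_vec (V : lmodType rat) (phi : forest -> V) f : extL phi (vec f) = phi f.
Proof. exact: extV. Qed.

Lemma vec_basis (V : lmodType rat) (g h : {linear HL -> V}) :
  (forall f, g (vec f) = h (vec f)) -> g =1 h.
Proof.
move=> E x; rewrite [LHS]linear_ext [RHS]linear_ext; apply: eq_ext => f; exact: E.
Qed.

Lemma top_linearl y : linear (top^~ y).
Proof. by move=> a x x'; rewrite topDl topZl. Qed.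

Lemma top_linearr x : linear (top x).
Proof. exact: linearP. Qed.

Lemma counit_eps x : counit F0 extL x = eps x.
Proof.
have L : linear (eps : HL -> rat^o) by move=> a y z; rewrite /eps mcoeffD mcoeffZ.
pose Lm := GRing.isLinear.Build rat HL rat^o *:%R _ L.
pose E : {linear HL -> rat^o} := HB.pack (eps : HL -> rat^o) Lm.
apply: (vec_basis (g := counit F0 extL) (h := E)) => f.
by rewrite [LHS]extL_vec /= /eps /vec mcoeffU eq_sym; case: eqP.
Qed.

Lemma counit_vec f : counit F0 extL (vec f) = (f == F0)%:R.
Proof. exact: extL_vec. Qed.

Lemma topB_grafts M N : topB M N = (wF N)%:R^-1 *: \sum_(g <- grafts M N) vec g.
Proof.
rewrite /topB /grafts big_map; case: ifP => // /eqP ->.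
by rewrite big_nil scaler0.
Qed.

Lemma topB_unit N : topB F0 N = vec N - (N == F0)%:R *: vec F0.
Proof.
rewrite topB_grafts; have [->|nN] := eqVneq N F0.
  by rewrite grafts_nil big_nil scaler0 scale1r subrr.
rewrite scale0r subr0 grafts1 big_nseq iter_addr_0.
by rewrite -scaler_nat scalerA mulVf ?scale1r // pnatr_eq0 wF_eq0.
Qed.

Lemma top_unit_vec x : top (vec F0) x = x - counit F0 extL x *: vec F0.
Proof.
have L : linear (fun x : HL => x - counit F0 extL x *: vec F0).
  move=> a y z; rewrite (linearP (counit F0 extL)) scalerDl -scalerA opprD addrACA.
  by rewrite scalerBr.
pose Lm := GRing.isLinear.Build rat HL HL *:%R _ L.
pose E : {linear HL -> HL} := HB.pack (fun x : HL => x - counit F0 extL x *: vec F0) Lm.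
apply: (vec_basis (g := top (vec F0)) (h := E)) => f.
rewrite -[RHS]/(vec f - counit F0 extL (vec f) *: vec F0) counit_vec -topB_unit.
by rewrite -[LHS]/(top (vec F0) (vec f)) topE extV extV.
Qed.

Lemma counit_top_vec x y : counit F0 extL (top x y) = 0.
Proof.
rewrite -[LHS]/(ext (fun f => (f == F0)%:R : rat^o) (top x y)) topE ext_comp.
rewrite -[RHS](ext_const0 _ x); apply: eq_ext => f.
rewrite ext_comp -[RHS](ext_const0 _ y); apply: eq_ext => g.
rewrite topB_grafts extZ ext_big big_seq big1 ?scaler0 // => h /grafts_neq0 /negPf hh.
by rewrite extV hh.
Qed.

Lemma primE p : prim F0 cuts extL p <-> forall (V : lmodType rat) (b : forest -> forest -> V),
  sweedler b p = ext (b^~ F0) p + ext (b F0) p.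
Proof. by []. Qed.

Lemma congr_add (V : nmodType) (a b c d : V) : a = c -> b = d -> a + b = c + d.
Proof. by move=> -> ->. Qed.

Lemma prim_primitive p : prim F0 cuts extL p <-> primitive p.
Proof.
split=> [/primE hp|hp]; last by apply/primE => V b; apply: sweedler_primitive.
rewrite /primitive.
have E1 : Delta p = sweedler (fun f g => vec2 (f, g)) p by exact: Delta_sweedler.
have E2 := hp H2 (fun f g => vec2 (f, g)).
apply: etrans E1 _.
apply: etrans E2 _.
apply: congr_add; apply: esym.
  exact: tensor2_One_r.
exact: tensor2_One_l.
Qed.

Lemma ext_tensor2_vec (V : lmodType rat) (b : forest * forest -> V) f y :
  ext b (tensor2 (vec f) y) = ext (fun g => b (f, g)) y.
Proof. exact: etrans (ext_tensor2 b _ y) (extV (fun f => ext (fun g => b (f, g)) y) f). Qed.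

Lemma sw_top_vec (V : lmodType rat) (b : forest -> forest -> V) x p :
  prim F0 cuts extL p ->
  sw cuts extL b (top x p) = extL (b^~ F0) (top x p) +
    sw cuts extL (fun f g => extL (b f) (top (vec g) p)) x.
Proof.
move=> /prim_primitive hp.
have E1 : sw cuts extL b (top x p) = ext (fun c => b c.1 c.2) (Delta (top x p)).
  exact: sweedlerE.
have E2 := congr1 (ext (fun c => b c.1 c.2)) (Delta_top x hp).
have E3 : ext (fun c => b c.1 c.2) (tensor2 (top x p) One) = ext (b^~ F0) (top x p).
  by rewrite ext_tensor2; apply: eq_ext => f; rewrite OneE extV.
have E4 : ext (fun c => b c.1 c.2) (sweedler (fun f g => tensor2 (vec f) (top (vec g) p)) x) =
    sweedler (fun f g => ext (b f) (top (vec g) p)) x.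
  rewrite /sweedler ext_comp; apply: eq_ext => f; rewrite ext_big.
  by apply: eq_bigr => c _; apply: ext_tensor2_vec.
apply: etrans E1 (etrans E2 _); rewrite extD; exact: congr_add E3 E4.
Qed.

Lemma coalg_endo_iff (Phi : {linear HL -> HL}) :
  is_coalgebra_endo F0 cuts vec extL Phi <-> coalg_endo Phi.
Proof.
split=> [[hsw hcounit]|[_ hD he]].
  split; first exact: linearP.
    move=> x.
    have E1 : Delta (Phi x) = sweedler (fun f g => vec2 (f, g)) (Phi x).
      exact: Delta_sweedler.
    have E2 := hsw H2 (fun f g => vec2 (f, g)) x.
    have E3 : sweedler (fun f g => bext extL (fun f g => vec2 (f, g)) (Phi (vec f)) (Phi (vec g))) x
        = tmap Phi (Delta x).
      rewrite tmapE sweedlerE; apply: eq_ext => c; exact/esym/tensor2E.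
    exact: etrans E1 (etrans E2 E3).
  by move=> x; rewrite -!counit_eps; apply: hcounit.
split=> [V b x|x]; last by rewrite !counit_eps.
have E1 : sw cuts extL b (Phi x) = ext (fun c => b c.1 c.2) (Delta (Phi x)).
  exact: sweedlerE.
have E2 := congr1 (ext (fun c => b c.1 c.2)) (hD x).
apply: etrans E1 (etrans E2 _); rewrite tmapE ext_comp.
apply: etrans (esym (sweedlerE (fun f g => bext extL b (Phi (vec f)) (Phi (vec g))) x)).
by apply: eq_ext => c; rewrite ext_tensor2.
Qed.

(** * Grouplike elements *)

Lemma ext_delta (K : choiceType) (x : {malg rat[K]}) m :
  ext (fun k => (k == m)%:R : rat^o) x = x@_m.
Proof.
have [hm|/mcoeff_outdom hm] := boolP (m \in msupp x); last first.
  rewrite hm /ext big_seq big1 // => k hk.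
  case: eqP hk => [->|_ _]; last by rewrite scaler0.
  by rewrite -mcoeff_neq0 hm eqxx.
rewrite /ext (big_fsetD1 m) //= eqxx big1_fset ?addr0; first exact: mulr1.
by move=> k; rewrite !inE => /andP[/negPf -> _] _; rewrite scaler0.
Qed.

(* The square of a monomial of a grouplike element occurs in the coproduct of
   a monomial of twice its weight, so only the unit monomial can occur. *)
Lemma grouplike_unit g : Delta g = tensor2 g g -> eps g = 1 -> g = One.
Proof.
move=> hg e1.
have heavier m : m \in msupp g -> m != F0 -> exists2 h, h \in msupp g & (wF m < wF h)%N.
  move=> hm m0.
  (* [b] reads off the coefficient of m (x) m, which in g (x) g is the square of that of m. *)
  pose b (f k : forest) : rat^o := (f == m)%:R * (k == m)%:R.
  have E1 : sweedler b g = g@_m * g@_m.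
    rewrite sweedlerE hg ext_tensor2 /b /=.
    transitivity (ext (fun f => (f == m)%:R *: (g@_m : rat^o)) g).
      by apply: eq_ext => f; rewrite -(ext_delta g m) -ext_scale.
    rewrite -[in RHS](ext_delta g m).
    transitivity (ext (fun f => g@_m *: ((f == m)%:R : rat^o)) g).
      by apply: eq_ext => f; exact: mulrC.
    by rewrite ext_scale ext_delta.
  have [[h hh hw]|none] := altP (@hasP _ (fun h => wF m < wF h)%N (msupp g)).
    by exists h.
  have : sweedler b g = 0.
    rewrite /sweedler /ext big_seq big1 // => h hh.
    rewrite big_seq big1 ?scaler0 // => c hc; rewrite /b.
    case: eqP => [c1|_]; last by rewrite mul0r.
    case: eqP => [c2|_]; last by rewrite mulr0.
    have := wF_cuts hc; rewrite c1 c2 => wh.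
    case/negP: none; apply/hasP; exists h => //; rewrite -wh -{1}[wF m]addn0 ltn_add2l.
    by rewrite lt0n wF_eq0.
  move/eqP; rewrite E1 mulf_eq0 orbb => /eqP gm.
  by move: hm; rewrite -mcoeff_neq0 gm eqxx.
have unit_only m : m \in msupp g -> m = F0.
  pose M := (\max_(h <- msupp g) wF h)%N.
  (* Induction on the gap to the largest weight: a nonunit [m] would have a heavier [h], which by
     induction is the unit, of weight 0. *)
  have [n] := ubnP (M - wF m); elim: n m => // n IH m; rewrite ltnS => hn hm.
  apply/eqP; apply: contraT => m0; have [h hh wmh] := heavier m hm m0.
  have hM : (wF h <= M)%N by apply: leq_bigmax_seq.
  have h0 : h = F0 by apply: IH => //; lia.
  by move: wmh; rewrite h0.
apply/malgP => k; rewrite OneE /vec mcoeffU; case: eqP => [<-|nk]; first exact: e1.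
by apply/mcoeff_outdom/negP => /unit_only hk; apply: nk.
Qed.

Definition primproj : {linear HL -> HL} := proj F0 cuts wF vec extL top.

Lemma prims_primitive ps : prims_seq F0 cuts extL ps <-> prims ps.
Proof. by split=> h q /h /prim_primitive. Qed.

Lemma primitive_primproj x : primitive (primproj x).
Proof.
apply/prim_primitive/(prim_proj wF_cuts wF_eq0 (fun V => @cuts_coassoc V)
  (fun V => @cuts_counitl V) (fun V => @cuts_counitr V) extL_vec vec_basis
  top_unit_vec counit_top_vec sw_top_vec).
Qed.

Lemma top_One_primitive p : primitive p -> top One p = p.
Proof.
move=> /prim_primitive hp; rewrite OneE.
exact: (top_unit_prim (fun V => @cuts_counitr V) extL_vec vec_basis top_unit_vec hp).
Qed.

Lemma topn_foldl ps : prims ps -> topn ps = foldl top (vec F0) ps.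
Proof.
case: ps => [//|p ps] hps; rewrite /= -OneE top_One_primitive //.
by apply: hps; rewrite inE eqxx.
Qed.

Lemma prims_split a ps : prims ps -> all (fun k => 0 < k)%N a -> sumn a = size ps ->
  forall r, r \in split_by a ps -> prims r /\ (0 < size r)%N.
Proof.
elim: a ps => //= k a IH ps hps /andP[k0 ha] hs r; rewrite inE => /orP[/eqP ->|].
  split; first by move=> q /mem_take /hps.
  by rewrite size_take; case: ifP => // _; rewrite -hs addn_gt0 k0.
apply: IH => //; first by move=> q /mem_drop /hps.
by rewrite size_drop -hs addKn.
Qed.

Lemma PhiRHS_comp_sum u ps :
  (forall qs, (0 < size qs)%N -> prims qs -> primitive (u (size qs) qs)) ->
  (0 < size ps)%N -> prims ps ->
  PhiRHS u ps = comp_sum top (fun qs => u (size qs) qs) (vec F0) ps.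
Proof.
move=> hu ps0 hps; rewrite PhiRHS_comps //; apply: eq_big_seq => a.
move=> /comps_sum /andP[/eqP hs ha]; apply: topn_foldl => q /mapP[r hr ->].
have [pr r0] := prims_split hps ha hs hr.
exact: hu.
Qed.

Lemma set_nth_cat (T : Type) (x0 : T) l1 x l2 y :
  set_nth x0 (l1 ++ x :: l2) (size l1) y = l1 ++ y :: l2.
Proof. by elim: l1 => //= z l1 ->. Qed.

Lemma admissible_linear (u : ufamily) l1 l2 a x y : admissible_family u ->
  prims l1 -> prims l2 -> primitive x -> primitive y ->
  u (size (l1 ++ (a *: x + y) :: l2)) (l1 ++ (a *: x + y) :: l2) =
  a *: u (size (l1 ++ x :: l2)) (l1 ++ x :: l2) + u (size (l1 ++ y :: l2)) (l1 ++ y :: l2).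
Proof.
move=> hu h1 h2 hx hy; pose n := (size l1 + (size l2).+1)%N.
have E v : u (size (l1 ++ v :: l2)) (l1 ++ v :: l2) =
    u n (set_nth 0 (l1 ++ x :: l2) (size l1) v) by rewrite size_cat set_nth_cat.
have n0 : (0 < n)%N by rewrite /n addnS.
have sz : size (l1 ++ x :: l2) = n by rewrite size_cat.
have hps : prims (l1 ++ x :: l2).
  by move=> q; rewrite mem_cat inE => /orP[/h1 //|/orP[/eqP -> //|/h2]].
have hlt : (size l1 < n)%N by rewrite /n addnS ltnS leq_addr.
have L := (hu _ n0).2 (l1 ++ x :: l2) (size l1) a x y sz hlt hps hx hy.
apply: etrans (E _) (etrans L _); apply: congr_add; last exact/esym/E.
exact (congr1 ( *:%R a) (esym (E x))).
Qed.

Lemma foldl_top_slot l1 l2 a x y :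
  foldl top (vec F0) (l1 ++ (a *: x + y) :: l2) =
  a *: foldl top (vec F0) (l1 ++ x :: l2) + foldl top (vec F0) (l1 ++ y :: l2).
Proof.
rewrite !foldl_cat /= linearP.
exact: (foldl_top_linear top_linearl).
Qed.

Lemma is_Phi_comp_sum u Phi ps : admissible_family u -> is_Phi u Phi -> prims ps ->
  Phi (foldl top (vec F0) ps) = comp_sum top (fun qs => u (size qs) qs) (vec F0) ps.
Proof.
move=> hu [_ Phi1 hPhi] hps.
case: (posnP (size ps)) => [/size0nil ->|ps0]; first by rewrite comp_sum_nil -OneE.
rewrite -topn_foldl // hPhi // PhiRHS_comp_sum // => qs qs0 hqs.
exact: (hu _ qs0).1.
Qed.

(** Existence and uniqueness of [Phi] in the first half express that the formula defines a linear
    map. In the second half families are compared at positive length on primitive lists, where they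
    represent maps on tensor powers. *)
Theorem theorem11p2 :
  (forall u : ufamily, admissible_family u ->
     exists Phi : H -> H,
       [/\ is_Phi u Phi,
           (forall Phi' : H -> H, is_Phi u Phi' -> forall x, Phi' x = Phi x)
         & coalg_endo Phi])
  /\
  (forall Phi : H -> H, coalg_endo Phi ->
     exists u : ufamily,
       [/\ admissible_family u, is_Phi u Phi
         & forall u' : ufamily, admissible_family u' -> is_Phi u' Phi ->
             forall (i : nat) (ps : seq H), (0 < i)%N -> size ps = i -> prims ps ->
               u' i ps = u i ps]).
Proof.
split=> [u hu|Phi hPhi].
  pose v qs := u (size qs) qs.
  have v_prim qs : (0 < size qs)%N -> prims qs -> primitive (v qs).
    by move=> qs0 hqs; apply: (hu _ qs0).1.
  have [Phi [Phi1 hco hv]] := @endo_of_family _ _ _ _ wF_cuts wF_eq0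
    (fun V => @cuts_coassoc V) (fun V => @cuts_counitl V) (fun V => @cuts_counitr V)
    _ _ _ extL_vec vec_basis _ top_linearl top_linearr top_unit_vec counit_top_vec
    sw_top_vec v
    (fun qs qs0 hqs => (prim_primitive _).2 (v_prim qs qs0 ((prims_primitive _).1 hqs)))
    (fun l1 l2 a x y h1 h2 hx hy => admissible_linear a hu ((prims_primitive _).1 h1)
      ((prims_primitive _).1 h2) ((prim_primitive _).1 hx) ((prim_primitive _).1 hy)).
  have hP : is_Phi u Phi.
    split; [exact: linearP | by rewrite OneE |] => ps ps0 hps.
    rewrite topn_foldl // hv; last exact/prims_primitive.
    by rewrite PhiRHS_comp_sum.
  exists Phi; split=> //; last exact/coalg_endo_iff.
  move=> Psi hPsi; have [Psi_lin _ _] := hPsi.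
  pose Lm := GRing.isLinear.Build rat HL HL *:%R Psi Psi_lin.
  pose Psi' : {linear HL -> HL} := HB.pack (Psi : HL -> HL) Lm.
  apply: (@iterated_span _ _ _ _ wF_cuts wF_eq0 (fun V => @cuts_coassoc V)
    (fun V => @cuts_counitl V) (fun V => @cuts_counitr V) _ _ _ extL_vec vec_basis _
    top_linearl top_linearr top_unit_vec counit_top_vec sw_top_vec _ Psi' Phi) => ps.
  move=> /prims_primitive hps.
  exact: etrans (is_Phi_comp_sum hu hPsi hps) (esym (is_Phi_comp_sum hu hP hps)).
have [Phi_lin hD he] := hPhi.
pose Lm := GRing.isLinear.Build rat HL HL *:%R Phi Phi_lin.
pose P : {linear HL -> HL} := HB.pack (Phi : HL -> HL) Lm.
(* The image of 1 under a coalgebra endomorphism is grouplike of counit 1. *)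
have Phi1 : Phi One = One.
  apply: grouplike_unit; last by rewrite he /eps OneE /vec mcoeffUU.
  rewrite hD tmapE -(sweedlerE (fun f g => tensor2 (Phi (vec f)) (Phi (vec g)))).
  by rewrite {1}OneE sweedlerU /cuts /= big_seq1 /= mkF_nil -OneE.
have hP : is_coalgebra_endo F0 cuts vec extL P by apply/coalg_endo_iff.
(* This is pi o Phi on iterated products; the length of the list carries the index i. *)
pose u (_ : nat) qs := primproj (Phi (foldl top (vec F0) qs)).
have hcomp ps : prims ps ->
    Phi (foldl top (vec F0) ps) = comp_sum top (fun qs => u (size qs) qs) (vec F0) ps.
  move=> /prims_primitive hps.
  have P1 : P (vec F0) = vec F0 by rewrite -OneE.
  exact: (@family_of_endo _ _ _ _ wF_cuts wF_eq0 (fun V => @cuts_counitl V) _ _ _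
    extL_vec vec_basis _ top_linearl top_linearr top_unit_vec counit_top_vec
    sw_top_vec P P1 hP ps hps).
exists u; split.
- move=> i i0; split=> [ps _ _|ps j a x y hs hj hps hx hy]; first exact: primitive_primproj.
  rewrite !set_nthE hs hj /u foldl_top_slot.
  have -> : Phi (a *: foldl top (vec F0) (take j ps ++ x :: drop j.+1 ps) +
      foldl top (vec F0) (take j ps ++ y :: drop j.+1 ps)) =
      a *: Phi (foldl top (vec F0) (take j ps ++ x :: drop j.+1 ps)) +
      Phi (foldl top (vec F0) (take j ps ++ y :: drop j.+1 ps)) by exact: Phi_lin.
  exact: linearP.
- split=> // ps ps0 hps; rewrite topn_foldl // hcomp //.
  by rewrite PhiRHS_comp_sum // => qs _ _; apply: primitive_primproj.
- move=> u' hu' hPhi' i ps + hsz; rewrite -hsz => ps0 hps.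
  have E := is_Phi_comp_sum hu' hPhi' hps.
  have Q := @proj_comp_sum _ _ _ _ wF_cuts wF_eq0 (fun V => @cuts_coassoc V)
    (fun V => @cuts_counitl V) (fun V => @cuts_counitr V) _ _ _ extL_vec vec_basis _
    top_linearl top_linearr top_unit_vec counit_top_vec sw_top_vec
    (fun qs => u' (size qs) qs) ps
    (fun qs qs0 hqs => (prim_primitive _).2
      ((hu' _ qs0).1 qs erefl ((prims_primitive _).1 hqs))) ps0
    ((prims_primitive _).2 hps).
  exact: esym (etrans (congr1 primproj E) Q).
Qed.
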